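(* Let $k\ge 1$ be an integer. There is $n_0=n_0(k)$ such that for every $n\ge n_0$ the following holds. Let $H$ be a $2k$-uniform hypergraph on $n$ vertices that contains no copy of ${\cal C}^{(2k)}_3$. Then $e(H)\le b_{2k}(n)$, and equality holds only if $H$ is isomorphic to ${\cal B}^{(2k)}(n,t)$ for some $t$ attaining the maximum in the definition of $b_{2k}(n)$.
   Context: For integers $k\ge1$, $r\ge 2$, ${\cal C}^{(2k)}_r$ denotes the $2k$-uniform hypergraph obtained by taking pairwise disjoint sets $P_1,\dots,P_r$ each of size $k$ and taking as edges all sets $P_i\cup P_j$ with $i\neq j$. For $n$ and $t$ with $n/2+t$ a nonnegative integer and $|t|\le n/2$, ${\cal B}^{(2k)}(n,t)$ is the $2k$-uniform hypergraph whose vertex set of size $n$ is partitioned into $V_1,V_2$ with $|V_1|=n/2+t$, $|V_2|=n/2-t$, and whose edges are all $2k$-subsets intersecting each of $V_1$ and $V_2$ in an odd number of elements. $b_{2k}(n,t)$ denotes its number of edges and $b_{2k}(n)=\max_t b_{2k}(n,t)$ over all admissible $t$. *)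

(* Defs.v *)
From mathcomp Require Import all_boot perm.
Set Implicit Arguments. Unset Strict Implicit. Unset Printing Implicit Defensive.

Definition uniform (n r : nat) (H : {set {set 'I_n}}) : Prop :=
  forall e, e \in H -> #|e| = r.

Definition has_C3 (n k : nat) (H : {set {set 'I_n}}) : Prop :=
  exists P1 P2 P3 : {set 'I_n},
    [/\ #|P1| = k, #|P2| = k & #|P3| = k] /\
    [/\ [disjoint P1 & P2], [disjoint P1 & P3] & [disjoint P2 & P3]] /\
    [/\ P1 :|: P2 \in H, P1 :|: P3 \in H & P2 :|: P3 \in H].

(* B^{(2k)}(n,t) with a = |V1| = n/2 + t, V1 = {0,..,a-1}, V2 its complement:
   all 2k-sets meeting V1 and V2 in an odd number of vertices. *)
Definition V1 (n a : nat) : {set 'I_n} := [set i : 'I_n | i < a].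

Definition Bhyp (n k a : nat) : {set {set 'I_n}} :=
  [set e : {set 'I_n} | (#|e| == 2 * k) && odd #|e :&: V1 n a|
                        && odd #|e :&: ~: V1 n a|].

(* b_{2k}(n) = max over admissible t, i.e. over a = n/2 + t in {0,..,n}. *)
Definition bmax (n k : nat) : nat := \max_(a < n.+1) #|Bhyp n k a|.

Definition hiso (n : nat) (H G : {set {set 'I_n}}) : Prop :=
  exists s : {perm 'I_n}, H = [set [set s x | x in e] | e : {set 'I_n} in G].

(* Main.v *)
(* Write h(X) for "the 2k-tuple X spans an edge of H". On k-tuples, h(P,Q) is a
   triangle-free graph of density about 1/2 (at least that of B(n,0)), so it is
   almost complete bipartite: h(P,Q) = f(P) + f(Q) mod 2 for almost all P, Q.
   As h is symmetric, exchanging a vertex of P with one of Q shows that f, hence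
   h, is almost everywhere a parity function X |-> sum of g(x) over x in X.

   If H has the maximum number of edges, replacing a vertex by a clone of another
   one cannot gain edges, so all degrees are nearly equal. This upgrades the
   structure to every vertex: after correcting g, for each x almost all tuples
   through x obey the parity rule.

   Let O be the odd sets of g. If a bad edge E in H \ O is split into two k-sets,
   then for each k-set R of the opposite parity the union of R with one of the
   halves is missing, i.e. in O \ H, so one of the halves is "heavy": it lies in a
   positive proportion of missing sets. Every bad edge then contains two heavy
   k-sets meeting in exactly one vertex, while each vertex lies in few heavy
   sets; counting gives 2 |H \ O| <= |O \ H|. Since |O| <= b(n) <= |H|, H = O. *)

Require Import Defs.
From mathcomp Require Import all_boot perm all_order all_algebra.
From mathcomp Require Import zify ring lra.
Set Implicit Arguments. Unset Strict Implicit. Unset Printing Implicit Defensive.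
Import Order.TTheory GRing.Theory Num.Theory.
Local Open Scope ring_scope.

(** * Averages and probabilities over finite types *)
Section Mean.
Variable R : realFieldType.
Implicit Types T U : finType.

Definition mean T (F : T -> R) : R := (\sum_x F x) / #|T|%:R.
Definition Pr T (p : T -> bool) : R := mean (fun x => (p x)%:R).

Lemma eq_mean T (F G : T -> R) : F =1 G -> mean F = mean G.
Proof. by move=> eFG; rewrite /mean (eq_bigr _ (fun x _ => eFG x)). Qed.

Lemma le_mean T (F G : T -> R) : (forall x, F x <= G x) -> mean F <= mean G.
Proof.
by move=> leFG; rewrite ler_wpM2r ?invr_ge0 ?ler0n//; apply: ler_sum => x _.
Qed.

Lemma meanD T (F G : T -> R) : mean (fun x => F x + G x) = mean F + mean G.
Proof. by rewrite /mean big_split mulrDl. Qed.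

Lemma meanZ T c (F : T -> R) : mean (fun x => c * F x) = c * mean F.
Proof. by rewrite /mean -mulr_sumr mulrA. Qed.

Lemma meanZr T c (F : T -> R) : mean (fun x => F x * c) = mean F * c.
Proof. by rewrite /mean -mulr_suml mulrAC. Qed.

Lemma mean_cst T c : (0 < #|T|)%N -> mean (fun _ : T => c) = c.
Proof.
by move=> T0; rewrite /mean sumr_const -[c *+ _]mulr_natr mulfK // pnatr_eq0 -lt0n.
Qed.

Lemma mean_ge0 T (F : T -> R) : (forall x, 0 <= F x) -> 0 <= mean F.
Proof. by move=> F0; rewrite mulr_ge0 ?invr_ge0 ?ler0n ?sumr_ge0. Qed.

Lemma mean_pair T U (F : T -> U -> R) :
  mean (fun u : T * U => F u.1 u.2) = mean (fun x => mean (F x)).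
Proof.
rewrite /mean -mulr_suml -mulrA card_prod natrM invfM; congr (_ * _).
  by rewrite pair_bigA.
by rewrite mulrC.
Qed.

Lemma mean_reindex T U (b : T -> U) (F : U -> R) :
  bijective b -> mean (fun x => F (b x)) = mean F.
Proof.
move=> bb; rewrite /mean (bij_eq_card bb) [in RHS](reindex b) //.
by case: bb => c bc cb; exists c => x _.
Qed.

Lemma mean_exists_ge T (F : T -> R) : (0 < #|T|)%N -> exists x, mean F <= F x.
Proof.
move=> /[dup] T0 /card_gt0P[x0 _].
have [x _ xP] := @arg_maxP _ R T x0 predT F isT.
by exists x; rewrite -[leRHS](@mean_cst T) //; apply: le_mean => y; apply: xP.
Qed.

Lemma mean_exists_le T (F : T -> R) : (0 < #|T|)%N -> exists x, F x <= mean F.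
Proof.
move=> /(mean_exists_ge (fun x => - F x))[x xP]; exists x.
rewrite -lerN2 (le_trans _ xP) // -[leLHS]mulN1r -meanZ.
by rewrite (eq_mean (fun x => mulN1r (F x))).
Qed.

Lemma eq_Pr T (p q : T -> bool) : p =1 q -> Pr p = Pr q.
Proof. by move=> e; apply: eq_mean => x; rewrite e. Qed.

Lemma le_Pr T (p q : T -> bool) : (forall x, p x -> q x) -> Pr p <= Pr q.
Proof.
move=> pq; apply: le_mean => x; rewrite ler_nat.
by case: (p x) (pq x) => // /(_ isT)->.
Qed.

Lemma Pr_ge0 T (p : T -> bool) : 0 <= Pr p.
Proof. by apply: mean_ge0 => x; rewrite ler0n. Qed.

Lemma Pr_union T (p q r : T -> bool) :
  (forall x, p x -> q x || r x) -> Pr p <= Pr q + Pr r.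
Proof.
move=> pqr; rewrite -meanD; apply: le_mean => x; rewrite -natrD ler_nat.
by case: (p x) (pqr x); case: (q x); case: (r x) => // /(_ isT).
Qed.

Lemma Pr_split T (q p : T -> bool) :
  Pr p = Pr (fun x => p x && q x) + Pr (fun x => p x && ~~ q x).
Proof.
rewrite -meanD; apply: eq_mean => x.
by case: (p x); case: (q x); rewrite /= ?addr0 ?add0r.
Qed.

Lemma PrC T (p : T -> bool) : (0 < #|T|)%N -> Pr (fun x => ~~ p x) = 1 - Pr p.
Proof.
move=> T0; have -> : 1 = Pr p + Pr (fun x => ~~ p x).
  by rewrite -[LHS](@mean_cst T) // -meanD; apply: eq_mean => x;
     case: (p x); rewrite /= ?addr0 ?add0r.
by rewrite addrC addKr.
Qed.

Lemma Pr_pair T U (p : T -> U -> bool) :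
  Pr (fun u : T * U => p u.1 u.2) = mean (fun x => Pr (p x)).
Proof. exact: mean_pair. Qed.

Lemma Pr_pairr T U (p : T -> U -> bool) :
  Pr (fun u : T * U => p u.1 u.2) = mean (fun y => Pr (fun x => p x y)).
Proof.
rewrite -Pr_pair; apply: (@mean_reindex _ _ (fun u : T * U => (u.2, u.1))
  (fun u => (p u.2 u.1)%:R)).
by exists (fun u => (u.2, u.1)) => -[].
Qed.

Lemma Pr_fst T U (p : T -> bool) :
  (0 < #|U|)%N -> Pr (fun u : T * U => p u.1) = Pr p.
Proof.
by move=> U0; rewrite (Pr_pair (fun x _ => p x)); apply: eq_mean => x; rewrite /Pr mean_cst.
Qed.

Lemma Pr_snd T U (p : U -> bool) :
  (0 < #|T|)%N -> Pr (fun u : T * U => p u.2) = Pr p.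
Proof. by move=> T0; rewrite (Pr_pair (fun _ => p)) mean_cst. Qed.

Lemma Pr_prod T U (p : T -> bool) (q : U -> bool) :
  Pr (fun u : T * U => p u.1 && q u.2) = Pr p * Pr q.
Proof.
rewrite (Pr_pair (fun x y => p x && q y)) -meanZr; apply: eq_mean => x.
by rewrite -meanZ; apply: eq_mean => y; case: (p x); rewrite ?mul1r ?mul0r.
Qed.

Lemma Pr_exists_le T U (p : T -> U -> bool) :
  (0 < #|U|)%N -> exists y, Pr (fun x => p x y) <= Pr (fun u : T * U => p u.1 u.2).
Proof. by move=> U0; rewrite Pr_pairr; apply: mean_exists_le. Qed.

Lemma Pr_card T (p : T -> bool) : (0 < #|T|)%N -> Pr p * #|T|%:R = #|[pred x | p x]|%:R.
Proof.
move=> T0; rewrite mulfVK ?pnatr_eq0 -?lt0n // -sum1_card natr_sum.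
by rewrite [RHS]big_mkcond; apply: eq_bigr => x _; rewrite inE; case: (p x).
Qed.

Lemma Pr_addb T U (p : T -> bool) (q : U -> bool) :
    (0 < #|T|)%N -> (0 < #|U|)%N ->
  Pr (fun u : T * U => p u.1 (+) q u.2) = Pr p * (1 - Pr q) + (1 - Pr p) * Pr q.
Proof.
move=> T0 U0; rewrite (Pr_split (fun u => p u.1)).
rewrite (@eq_Pr _ _ (fun u => p u.1 && ~~ q u.2)); last first.
  by move=> u; case: (p u.1); case: (q u.2).
rewrite [X in _ + X](@eq_Pr _ _ (fun u => ~~ p u.1 && q u.2)); last first.
  by move=> u; case: (p u.1); case: (q u.2).
by rewrite (Pr_prod p (fun x => ~~ q x)) (Pr_prod (fun x => ~~ p x) q) !PrC.
Qed.

Lemma Pr_neq_prod T (p : T -> bool) : (0 < #|T|)%N ->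
  Pr (fun u : T * T => p u.1 (+) p u.2) = 2 * (Pr p * (1 - Pr p)).
Proof. by move=> T0; rewrite Pr_addb //; ring. Qed.

End Mean.

(** * Uniformly random tuples, entries independent and possibly repeated *)

Section TupleMean.
Variables (R : realFieldType) (V : finType).
Hypothesis V0 : (0 < #|V|)%N.
Local Notation Pr := (@Pr R _).

Lemma card_tuple_gt0 m : (0 < #|{: m.-tuple V}|)%N.
Proof. by rewrite card_tuple expn_gt0 V0. Qed.

Lemma bij_tuple_cons m :
  bijective (fun u : V * m.-tuple V => [tuple of u.1 :: u.2]).
Proof.
exists (fun t => (thead t, [tuple of behead t])) => [[x t]|t] /=.
  by congr pair; apply/val_inj.
by rewrite [RHS]tuple_eta.
Qed.

Lemma bij_tuple_cat a b :
  bijective (fun u : a.-tuple V * b.-tuple V => [tuple of u.1 ++ u.2]).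
Proof.
apply: inj_card_bij => [[s t] [s' t'] /(congr1 val)/= /eqP|].
  by rewrite eqseq_cat ?size_tuple // => /andP[/eqP/val_inj-> /eqP/val_inj->].
by rewrite card_prod !card_tuple expnD.
Qed.

Lemma Pr_tuple_cons m (p : seq V -> bool) :
  Pr (fun t : m.+1.-tuple V => p t) = Pr (fun u : V * m.-tuple V => p (u.1 :: u.2)).
Proof. by symmetry; apply: (mean_reindex (fun t => (p _)%:R) (bij_tuple_cons m)). Qed.

Lemma Pr_tuple_cat a b (p : seq V -> bool) :
  Pr (fun t : (a + b).-tuple V => p t) =
  Pr (fun u : a.-tuple V * b.-tuple V => p (u.1 ++ u.2)).
Proof. by symmetry; apply: (mean_reindex (fun t => (p _)%:R) (bij_tuple_cat a b)). Qed.

Lemma Pr_tuple0 (p : seq V -> bool) : Pr (fun t : 0.-tuple V => p t) = (p [::])%:R.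
Proof.
rewrite /Pr (@eq_mean _ _ _ (fun=> (p [::])%:R)) => [|t]; last by rewrite tuple0.
by rewrite mean_cst ?card_tuple_gt0.
Qed.

End TupleMean.

(** * Stability *)
Section Stability.
Variable R : realFieldType.
Local Notation Pr := (@Pr R _).

Lemma Pr_reindex (T U : finType) (b : T -> U) (p : U -> bool) :
  bijective b -> Pr (fun x => p (b x)) = Pr p.
Proof. exact: mean_reindex. Qed.

(** With [d] the neighbourhood density and [p] the edge density, the average of [d x + d y] over
    edges is [2 * mean (d ^ 2) / p], hence at least [2 * p] by Cauchy-Schwarz. The slack [e] makes
    the inequality strict. *)
Lemma exists_dense_edge (T : finType) (G : rel T) (e : R) :
    (0 < #|T|)%N -> symmetric G -> 0 < e -> 0 < Pr (fun u => G u.1 u.2) ->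
  exists x y, G x y /\
    2 * Pr (fun u => G u.1 u.2) - e < Pr (G x) + Pr (G y).
Proof.
move=> T0 Gs e0; set p := Pr _ => p0.
pose d x := Pr (G x).
have dE : mean d = p by rewrite /p Pr_pair.
have d2 : p ^+ 2 <= mean (fun x => d x * d x).
  have : 0 <= mean (fun x => (d x - p) ^+ 2) by apply: mean_ge0 => x; apply: sqr_ge0.
  rewrite (@eq_mean _ _ _ (fun x => d x * d x + (d x * (- 2 * p) + p ^+ 2))); last first.
    by move=> x; ring.
  by rewrite !meanD meanZr mean_cst // dE; lra.
(* The mean of [F] is at least [e * p > 0], and a pair where [F] is positive has to be an edge. *)
pose F (u : T * T) := (G u.1 u.2)%:R * (d u.1 + d u.2 - (2 * p - e)).
have mF : mean F = 2 * mean (fun x => d x * d x) - (2 * p - e) * p.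
  rewrite (mean_pair (fun x y => (G x y)%:R * (d x + d y - (2 * p - e)))).
  rewrite (@eq_mean _ _ _ (fun x => (d x * d x + mean (fun y => (G x y)%:R * d y)) +
     d x * - (2 * p - e))); last first.
    move=> x; rewrite -!meanZr -meanD -meanD; apply: eq_mean => y; ring.
  rewrite !meanD meanZr dE.
  have -> : mean (fun x => mean (fun y => (G x y)%:R * d y)) = mean (fun x => d x * d x).
    rewrite -(mean_pair (fun x y => (G x y)%:R * d y)).
    rewrite -(@mean_reindex _ _ _ (fun u : T * T => (u.2, u.1))) /=; last first.
      by exists (fun u => (u.2, u.1)) => -[].
    rewrite (mean_pair (fun x y => (G y x)%:R * d x)); apply: eq_mean => x.
    by rewrite meanZr; congr (_ * _); apply: eq_mean => y; rewrite Gs.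
  lra.
have TT0 : (0 < #|{: T * T}|)%N by rewrite card_prod muln_gt0 T0.
have [[x y] Fxy] := mean_exists_ge F TT0.
have : 0 < F (x, y) by apply: lt_le_trans Fxy; rewrite mF; nra.
rewrite /F /=; case Gxy : (G x y); last by rewrite mul0r ltxx.
by rewrite mul1r => H; exists x, y; split => //; rewrite /d in H; lra.
Qed.

(** For an edge [x0 y0] of large degree sum, the two neighbourhoods are disjoint, span no edge, and
    miss measure at most [3 * e]. Colour by adjacency to [x0]: monochromatic edges have measure at
    most [6 * e]. Bichromatic pairs have measure at most 1/2, so at most [7 * e] of them are
    non-edges. *)
Lemma triangle_free_stability (T : finType) (G : rel T) (e : R) :
    (0 < #|T|)%N -> symmetric G ->
    (forall x y z, G x y -> G x z -> G y z -> False) ->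
    0 < e -> e < 2^-1 -> 2^-1 - e <= Pr (fun u => G u.1 u.2) ->
  exists x0, Pr (fun u => G u.1 u.2 != (G x0 u.1 (+) G x0 u.2)) <= 13 * e.
Proof.
move=> T0 Gs Gtf e0 e1 Ge.
have p0 : 0 < Pr (fun u => G u.1 u.2) by lra.
have [x0 [y0 [Gxy dxy]]] := exists_dense_edge T0 Gs e0 p0.
exists x0; set f := G x0.
pose out x := ~~ f x && ~~ G y0 x.
have Pout : Pr out <= 3 * e.
  have : Pr (G x0) + Pr (G y0) <= 1 - Pr out.
    rewrite -PrC // -meanD; apply: le_mean => x; rewrite -natrD ler_nat /out /f.
    by case E1: (G x0 x); case E2: (G y0 x) => //; case: (Gtf _ _ _ Gxy E1 E2).
  by lra.
have Peq : Pr (fun u => G u.1 u.2 && (f u.1 == f u.2)) <= 6 * e.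
  have := @Pr_union R _ (fun u : T * T => G u.1 u.2 && (f u.1 == f u.2))
    (fun u => out u.1) (fun u => out u.2).
  rewrite Pr_fst // Pr_snd // => H; apply: le_trans (_ : _ <= Pr out + Pr out) _; last lra.
  apply: H => -[x y] /= /andP[Gu]; rewrite /out /f => /eqP fe.
  case E1: (G x0 x) fe => /= fe; first by case: (Gtf x0 x y).
  rewrite -fe /=; case E2: (G y0 x) => //=; case E3: (G y0 y) => //.
  by case: (Gtf y0 x y).
have Pne : Pr (fun u => f u.1 (+) f u.2) <= 2^-1.
  by rewrite Pr_neq_prod //; have := sqr_ge0 (2 * Pr f - 1); nra.
have sp1 := Pr_split R (fun u : T * T => f u.1 == f u.2) (fun u : T * T => G u.1 u.2).
have sp2 := Pr_split R (fun u : T * T => G u.1 u.2) (fun u : T * T => f u.1 (+) f u.2).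
have E : Pr (fun u => G u.1 u.2 && (f u.1 != f u.2)) =
         Pr (fun u => (f u.1 (+) f u.2) && G u.1 u.2).
  by apply: eq_Pr => -[x y] /=; rewrite andbC; case: (f x); case: (f y).
have := @Pr_union R _ (fun u => G u.1 u.2 != (f u.1 (+) f u.2))
  (fun u => G u.1 u.2 && (f u.1 == f u.2)) (fun u => (f u.1 (+) f u.2) && ~~ G u.1 u.2).
move=> /(_ _)/le_trans; apply; first by move=> [x y] /=; case: (G _ _); case: (f _); case: (f _).
lra.
Qed.

(** * Parity functions and functions that are almost additive *)

Variables (V : finType).
Hypothesis V0 : (0 < #|V|)%N.

Definition perm_invariant (A : Type) (f : seq V -> A) := forall s t, perm_eq s t -> f s = f t.

Definition par (g : V -> bool) (s : seq V) : bool := odd (count g s).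

Lemma par_sym g : perm_invariant (par g).
Proof. by move=> s t /seq.permP st; rewrite /par st. Qed.

Lemma par_cons g x s : par g (x :: s) = g x (+) par g s.
Proof. by rewrite /par /= oddD oddb. Qed.

Lemma par_cat g s t : par g (s ++ t) = par g s (+) par g t.
Proof. by rewrite /par count_cat oddD. Qed.

Lemma Pr_cons2 m m' (p : seq V -> seq V -> bool) :
  Pr (fun u : m.+1.-tuple V * m'.+1.-tuple V => p u.1 u.2) =
  Pr (fun u : (V * m.-tuple V) * (V * m'.-tuple V) =>
    p (u.1.1 :: u.1.2) (u.2.1 :: u.2.2)).
Proof.
rewrite (Pr_pairr R (fun (s : m.+1.-tuple V) (t : m'.+1.-tuple V) => p s t)).
rewrite (@eq_mean _ _ _ (fun t : m'.+1.-tuple V =>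
  Pr (fun s : V * m.-tuple V => p (s.1 :: s.2) t))); last first.
  by move=> t; apply: (Pr_tuple_cons _ _ (fun s => p s t)).
rewrite -(Pr_pairr R (fun (s : V * m.-tuple V) (t : m'.+1.-tuple V) => p (s.1 :: s.2) t)).
rewrite (Pr_pair R (fun (s : V * m.-tuple V) (t : m'.+1.-tuple V) => p (s.1 :: s.2) t)).
rewrite [RHS](Pr_pair R (fun (s : V * m.-tuple V) (t : V * m'.-tuple V) => p (s.1 :: s.2) (t.1 :: t.2))).
by apply: eq_mean => s; apply: (Pr_tuple_cons _ _ (fun t => p (s.1 :: s.2) t)).
Qed.

Lemma card_pair_gt0 (T U : finType) : (0 < #|T|)%N -> (0 < #|U|)%N -> (0 < #|{: T * U}|)%N.
Proof. by rewrite card_prod muln_gt0 => -> ->. Qed.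

(* Replace the entries of one tuple by those of the other one at a time. *)
Lemma perm_invariant_almost_cst m (psi : seq V -> bool) (d : R) :
    perm_invariant psi -> 0 <= d ->
    (forall m', m = m'.+1 ->
      Pr (fun u : V * V * m'.-tuple V => psi (u.1.1 :: u.2) != psi (u.1.2 :: u.2)) <= d) ->
  Pr (fun u : m.-tuple V * m.-tuple V => psi u.1 != psi u.2) <= m%:R * d.
Proof.
move=> ps d0 Hd.
(* Induction on the number [j] of entries still to be replaced; the last component is the part
   already common to both tuples. *)
have H : forall j l, (j + l = m)%N ->
  Pr (fun u : j.-tuple V * j.-tuple V * l.-tuple V =>
    psi (u.1.1 ++ u.2) != psi (u.1.2 ++ u.2)) <= j%:R * d.
  elim=> [|j IHj] l jl.
    rewrite (@eq_Pr _ _ _ (fun=> false)) /Pr ?mean_cst ?mul0r //.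
      by rewrite !card_pair_gt0 ?card_tuple_gt0.
    by move=> [[P Q] S] /=; rewrite (tuple0 P) (tuple0 Q) eqxx.
  rewrite (Pr_pairr R (fun (w : j.+1.-tuple V * j.+1.-tuple V) (S : l.-tuple V) =>
    psi (w.1 ++ S) != psi (w.2 ++ S))).
  rewrite (@eq_mean _ _ _ (fun S : l.-tuple V =>
    Pr (fun w : (V * j.-tuple V) * (V * j.-tuple V) =>
      psi (w.1.1 :: w.1.2 ++ S) != psi (w.2.1 :: w.2.2 ++ S)))); last first.
    by move=> S; apply: (Pr_cons2 _ _ (fun s t => psi (s ++ S) != psi (t ++ S))).
  rewrite -(Pr_pairr R (fun (w : (V * j.-tuple V) * (V * j.-tuple V)) (S : l.-tuple V) =>
    psi (w.1.1 :: w.1.2 ++ S) != psi (w.2.1 :: w.2.2 ++ S))).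
  pose X := ((V * j.-tuple V) * (V * j.-tuple V) * l.-tuple V)%type.
  (* [E1] replaces the first entry [x] by [y]; [E2] then replaces the remaining [P] by [Q], with [y]
     moved into the common part. *)
  pose E1 (u : X) := psi (u.1.1.1 :: u.1.1.2 ++ u.2) != psi (u.1.2.1 :: u.1.1.2 ++ u.2).
  pose E2 (u : X) := psi (u.1.1.2 ++ u.1.2.1 :: u.2) != psi (u.1.2.2 ++ u.1.2.1 :: u.2).
  have P1 : Pr E1 <= d.
    have jlm : m = (j + l).+1 by rewrite -jl addSn.
    apply: le_trans (Hd _ jlm).
    (* The coordinate on which the event does not depend is moved to the end and averaged out. *)
    pose Y := (V * V * (j.-tuple V * l.-tuple V) * j.-tuple V)%type.
    rewrite -(@Pr_reindex _ _ (fun u : Y =>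
      ((u.1.1.1, u.1.2.1), (u.1.1.2, u.2), u.1.2.2) : X)); last first.
      by exists (fun v : X => ((v.1.1.1, v.1.2.1), (v.1.1.2, v.2), v.1.2.2)) => -[[[??][??]]?] /=.
    rewrite /E1 /=.
    rewrite (@Pr_fst R _ _ (fun w : V * V * (j.-tuple V * l.-tuple V) =>
      psi (w.1.1 :: w.2.1 ++ w.2.2) != psi (w.1.2 :: w.2.1 ++ w.2.2))) ?card_tuple_gt0 //.
    rewrite (Pr_pair R (fun w (t : j.-tuple V * l.-tuple V) =>
      psi (w.1 :: t.1 ++ t.2) != psi (w.2 :: t.1 ++ t.2))).
    rewrite (Pr_pair R (fun w (t : (j + l).-tuple V) => psi (w.1 :: t) != psi (w.2 :: t))).
    apply: le_mean => w.
    by rewrite (Pr_tuple_cat _ _ _ (fun t => psi (w.1 :: t) != psi (w.2 :: t))).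
  have P2 : Pr E2 <= j%:R * d.
    apply: le_trans (IHj l.+1 _); last by rewrite addnS.
    pose Y := ((j.-tuple V * j.-tuple V) * (V * l.-tuple V) * V)%type.
    rewrite -(@Pr_reindex _ _ (fun u : Y =>
      ((u.2, u.1.1.1), (u.1.2.1, u.1.1.2), u.1.2.2) : X)); last first.
      by exists (fun v : X => ((v.1.1.2, v.1.2.2), (v.1.2.1, v.2), v.1.1.1)) => -[[[??][??]]?] /=.
    rewrite /E2 /=.
    rewrite (@Pr_fst R _ _ (fun w : (j.-tuple V * j.-tuple V) * (V * l.-tuple V) =>
      psi (w.1.1 ++ w.2.1 :: w.2.2) != psi (w.1.2 ++ w.2.1 :: w.2.2))) //.
    rewrite (Pr_pair R (fun (w : j.-tuple V * j.-tuple V) (t : V * l.-tuple V) =>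
      psi (w.1 ++ t.1 :: t.2) != psi (w.2 ++ t.1 :: t.2))).
    rewrite (Pr_pair R (fun (w : j.-tuple V * j.-tuple V) (t : l.+1.-tuple V) =>
      psi (w.1 ++ t) != psi (w.2 ++ t))).
    apply: le_mean => w.
    by rewrite (Pr_tuple_cons _ _ (fun t => psi (w.1 ++ t) != psi (w.2 ++ t))).
  rewrite -natr1 mulrDl mul1r.
  apply: le_trans (_ : _ <= Pr E2 + Pr E1) _; last by rewrite lerD.
  apply: Pr_union => -[[[x P][y Q]] S]; rewrite /E1 /E2 /=.
  have e1 : psi (P ++ y :: S) = psi (y :: P ++ S) by apply: ps; rewrite perm_catC /= perm_cons perm_catC.
  have e2 : psi (Q ++ y :: S) = psi (y :: Q ++ S) by apply: ps; rewrite perm_catC /= perm_cons perm_catC.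
  by rewrite e1 e2; case: (psi _); case: (psi _); case: (psi _).
have := H m 0%N (addn0 m).
rewrite (@eq_Pr _ _ _ (fun u : m.-tuple V * m.-tuple V * 0.-tuple V =>
  psi u.1.1 != psi u.1.2)).
  by rewrite (@Pr_fst R _ _ (fun w : m.-tuple V * m.-tuple V => psi w.1 != psi w.2)) ?card_tuple_gt0.
by move=> [[P Q] S] /=; rewrite (tuple0 S) !cats0.
Qed.

Lemma perm_swap (x y : V) s t : perm_eq (x :: s ++ y :: t) (y :: s ++ x :: t).
Proof. by apply/seq.permP => p; rewrite /= !count_cat /=; lia. Qed.

(** By symmetry of [h], the effect on [f] of changing [x] to [y] hardly depends on the other
    entries. Hence [f] plus a suitable [par g] is almost constant, and the constant cancels in
    [f P (+) f Q]. The error is [e] for [f] and [2 * e] for each of the [k.+1] replacements. *)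
Lemma par_stability k (h f : seq V -> bool) (e : R) : perm_invariant h -> perm_invariant f ->
    Pr (fun u : k.+1.-tuple V * k.+1.-tuple V => h (u.1 ++ u.2) != f u.1 (+) f u.2) <= e ->
  exists g, Pr (fun u : k.+1.-tuple V * k.+1.-tuple V =>
    h (u.1 ++ u.2) != par g (u.1 ++ u.2)) <= (1 + 2 * k.+1%:R) * e.
Proof.
move=> hs fs hf.
have e0 : 0 <= e by apply: le_trans hf; apply: Pr_ge0.
pose X := ((V * k.-tuple V) * (V * k.-tuple V))%type.
pose A (u : X) := h (u.1.1 :: u.1.2 ++ u.2.1 :: u.2.2)
  != f (u.1.1 :: u.1.2) (+) f (u.2.1 :: u.2.2).
have PA : Pr A <= e.
  by rewrite -(Pr_cons2 _ _ (fun s t => h (s ++ t) != f s (+) f t)).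
pose A' (u : X) := A ((u.2.1, u.1.2), (u.1.1, u.2.2)).
have PA' : Pr A' <= e.
  rewrite /A' (Pr_reindex (b := fun u : X => ((u.2.1, u.1.2), (u.1.1, u.2.2)))) //.
  by exists (fun u : X => ((u.2.1, u.1.2), (u.1.1, u.2.2))) => -[[??][??]].
(* [x :: S ++ y :: T] and [y :: S ++ x :: T] have the same [h], so [B] occurs only if one of these
   two splittings is exceptional for [f]. *)
pose B (w : V * V * k.-tuple V) (t : k.-tuple V) :=
  f (w.1.1 :: w.2) (+) f (w.1.2 :: w.2) != f (w.1.1 :: t) (+) f (w.1.2 :: t).
have PB : Pr (fun u => B u.1 u.2) <= 2 * e.
  rewrite -(@Pr_reindex _ _ (fun u : X => ((u.1.1, u.2.1), u.1.2, u.2.2))); last first.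
    by exists (fun v : V * V * k.-tuple V * k.-tuple V =>
      ((v.1.1.1, v.1.2), (v.1.1.2, v.2))) => [[[??][??]]|[[[??]?]?]].
  apply: le_trans (_ : _ <= Pr A + Pr A') _; last lra.
  apply: Pr_union => -[[x S] [y T]]; rewrite /A' /A /B /= (hs _ _ (perm_swap x y S T)).
  by case: (h _); case: (f _); case: (f _); case: (f _); case: (f _).
have [T0 PT0] := Pr_exists_le R B (card_tuple_gt0 V0 k).
(* [T0] is a base point whose exceptional measure is at most the average one. *)
pose g x := f (x :: T0).
exists g; pose psi s := f s (+) par g s.
have := @perm_invariant_almost_cst k.+1 psi (2 * e) _ _ _.
have psis : perm_invariant psi by move=> s t st; rewrite /psi (fs _ _ st) (par_sym _ st).
move=> /(_ psis) H; have {H}/H : 0 <= 2 * e by lra.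
move=> /(_ _)/le_trans H.
apply: le_trans (_ : _ <= e + k.+1%:R * (2 * e)) _; last lra.
apply: le_trans (lerD hf (H _ _ (lexx _))).
  apply: Pr_union => -[P Q]; rewrite /psi par_cat /=.
  by case: (h _); case: (f _); case: (f _); case: (par _ _); case: (par _ _).
move=> m' [<-]; apply: le_trans (le_trans PT0 PB); apply: le_Pr => -[[x y] S].
rewrite /B /psi /g /= !par_cons.
by case: (f _); case: (f _); case: (f _); case: (f _); case: (par _ _).
Qed.

End Stability.

(** * From global to vertex-wise structure *)
Section Vertex.
Variables (R : realFieldType) (V : finType).
Hypothesis V0 : (0 < #|V|)%N.
Local Notation Pr := (@Pr R _).
Variables (k : nat) (h : seq V -> bool).
Hypothesis h_sym : perm_invariant h.
Hypothesis h_tf : forall P Q S : k.+1.-tuple V,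
  h (P ++ Q) -> h (P ++ S) -> h (Q ++ S) -> False.

(* For a fixed [x] and [S], the [Q] with [h (x :: S ++ Q)] are independent in
   the almost complete bipartite graph on (k+1)-tuples, so almost all of them
   have one parity [sigma S]. *)
Lemma vertex_par (g : V -> bool) (eta : R) (x : V) :
    0 <= eta ->
    Pr (fun u : k.+1.-tuple V * k.+1.-tuple V =>
      h (u.1 ++ u.2) != par g (u.1 ++ u.2)) <= eta ^+ 2 ->
    `|1 - 2 * Pr (fun Q : k.+1.-tuple V => par g Q)| <= eta ->
    2^-1 - eta <= Pr (fun u : k.-tuple V * k.+1.-tuple V => h (x :: u.1 ++ u.2)) ->
  exists c, Pr (fun u : k.-tuple V * k.+1.-tuple V =>
    h (x :: u.1 ++ u.2) != c (+) par g (u.1 ++ u.2)) <= (2 * k%:R + 1) * (4 * eta).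
Proof.
move=> eta0 Hg; rewrite ler_norml => /andP[Hb1 Hb2] Hd.
pose a b S := Pr (fun Q : k.+1.-tuple V => h (x :: S ++ Q) && (par g Q == b)).
have a_sym b : perm_invariant (a b).
  move=> S S' SS'; apply: eq_Pr => Q; congr (_ && _).
  by apply: h_sym; rewrite perm_cons perm_cat2r.
(* If [Q] and [Q'] have opposite parities and both form an edge with [x :: S], then [Q ++ Q'] is odd
   but cannot be an edge: an exception to the parity rule. *)
have a2 (S : k.-tuple V) : a true S * a false S <= eta ^+ 2.
  rewrite -Pr_prod; apply: le_trans Hg; apply: le_Pr => -[Q Q'] /=.
  move=> /andP[/andP[hQ /eqP pQ] /andP[hQ' /eqP pQ']].
  rewrite par_cat pQ pQ' /=; apply/negP => /eqP hQQ'.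
  exact: (@h_tf [tuple of x :: S] Q Q').
pose sigma S := a false S <= a true S.
have s_sym : perm_invariant sigma.
  by move=> S S' SS'; rewrite /sigma (a_sym true _ _ SS') (a_sym false _ _ SS').
(* [sigma S] is the majority parity, and the smaller of two factors with product at most [eta ^+ 2]
   is at most [eta]. *)
have as_le (S : k.-tuple V) : a (~~ sigma S) S <= eta.
  have := a2 S; have := Pr_ge0 R (fun Q : k.+1.-tuple V => h (x :: S ++ Q) && (par g Q == false)).
  have := Pr_ge0 R (fun Q : k.+1.-tuple V => h (x :: S ++ Q) && (par g Q == true)).
  rewrite -/(a true S) -/(a false S) /sigma.
  case: (leP (a false S) (a true S)) => /= c h1 h2 h3; rewrite leNgt; apply/negP => h4; nra.
pose X := (k.-tuple V * k.+1.-tuple V)%type.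
pose hx (u : X) := h (x :: u.1 ++ u.2).
pose ps (u : X) := par g u.2 == sigma u.1.
have P1 : Pr (fun u => hx u && ~~ ps u) <= eta.
  rewrite (Pr_pair R (fun (S : k.-tuple V) (Q : k.+1.-tuple V) =>
     h (x :: S ++ Q) && ~~ (par g Q == sigma S))).
  rewrite -[leRHS](@mean_cst R {: k.-tuple V}) ?card_tuple_gt0 //.
  apply: le_mean => S; apply: le_trans (as_le S); apply: le_Pr => Q.
  by case: (h _); case: (par _ _); case: (sigma _).
have P2 : Pr ps <= (1 + eta) / 2.
  rewrite (Pr_pair R (fun (S : k.-tuple V) (Q : k.+1.-tuple V) => par g Q == sigma S)).
  rewrite -[leRHS](@mean_cst R {: k.-tuple V}) ?card_tuple_gt0 //.
  apply: le_mean => S; case: (sigma S).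
    rewrite (@eq_Pr _ _ _ (fun Q : k.+1.-tuple V => par g Q)); last by move=> Q; case: par.
    by lra.
  rewrite (@eq_Pr _ _ _ (fun Q : k.+1.-tuple V => ~~ par g Q)); last by move=> Q; case: par.
  by rewrite PrC ?card_tuple_gt0 //; lra.
(* Edges outside [ps] have measure at most [eta]. As [ps] has measure at most [(1 + eta) / 2] and
   contains edges of measure at least [2^-1 - 2 * eta], its non-edges have measure at most
   [5 / 2 * eta]. *)
have P3 : Pr (fun u => hx u != ps u) <= 4 * eta.
  have s1 := Pr_split R ps hx; have s2 := Pr_split R hx ps.
  have E : Pr (fun u => hx u && ps u) = Pr (fun u => ps u && hx u).
    by apply: eq_Pr => u; rewrite andbC.
  have U : Pr (fun u => hx u != ps u) <=
     Pr (fun u => hx u && ~~ ps u) + Pr (fun u => ps u && ~~ hx u).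
    by apply: Pr_union => u; case: (hx u); case: (ps u).
  move: Hd; rewrite -/(Pr hx); lra.
(* As in the global case, exchanging an entry of [S] with one of [Q] shows that [psi] is almost
   constant, so [sigma] is almost a parity function up to a constant. *)
pose psi S := sigma S (+) par g S.
have psi_sym : perm_invariant psi by move=> s t st; rewrite /psi (s_sym _ _ st) (par_sym _ st).
have Ppsi : Pr (fun u : k.-tuple V * k.-tuple V => psi u.1 != psi u.2) <= k%:R * (8 * eta).
  apply: (perm_invariant_almost_cst V0 psi_sym) => [|m km]; first by lra.
  pose A (u : (V * m.-tuple V) * (V * k.-tuple V)) :=
    h (x :: (u.1.1 :: u.1.2) ++ (u.2.1 :: u.2.2)) !=
    (par g (u.2.1 :: u.2.2) == sigma (u.1.1 :: u.1.2)).
  have PA : Pr A <= 4 * eta.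
    apply: le_trans P3; rewrite /hx /ps.
    have := Pr_cons2 R m k (fun s t => h (x :: s ++ t) != (par g t == sigma s)).
    rewrite /A => <-; have -> // : forall m', k = m' ->
      Pr (fun u : m'.-tuple V * k.+1.-tuple V => h (x :: u.1 ++ u.2) != (par g u.2 == sigma u.1)) =
      Pr (fun u : X => h (x :: u.1 ++ u.2) != (par g u.2 == sigma u.1)).
    by move=> m' <-.
  pose A' (u : (V * m.-tuple V) * (V * k.-tuple V)) := A ((u.2.1, u.1.2), (u.1.1, u.2.2)).
  have PA' : Pr A' <= 4 * eta.
    rewrite /A' (Pr_reindex R (b := fun u : (V * m.-tuple V) * (V * k.-tuple V) =>
       ((u.2.1, u.1.2), (u.1.1, u.2.2)))) //.
    by exists (fun u : (V * m.-tuple V) * (V * k.-tuple V) =>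
      ((u.2.1, u.1.2), (u.1.1, u.2.2))) => -[[??][??]].
  rewrite -(@Pr_fst R _ {: k.-tuple V}) ?card_tuple_gt0 //.
  rewrite -(@Pr_reindex R _ _ (fun u : (V * m.-tuple V) * (V * k.-tuple V) =>
     ((u.1.1, u.2.1), u.1.2, u.2.2))); last first.
    by exists (fun v : V * V * m.-tuple V * k.-tuple V =>
      ((v.1.1.1, v.1.2), (v.1.1.2, v.2))) => [[[??][??]]|[[[??]?]?]].
  apply: le_trans (_ : _ <= Pr A + Pr A') _; last by lra.
  apply: Pr_union => -[[y S] [z Q]]; rewrite /A' /A /psi /= !par_cons.
  have -> : h [:: x, z & S ++ y :: Q] = h [:: x, y & S ++ z :: Q].
    by apply: h_sym; rewrite perm_cons perm_swap.
  by case: (h _); case: (sigma _); case: (sigma _); case: (g y); case: (g z);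
     case: (par _ S); case: (par _ Q).
have [S2 PS2] := Pr_exists_le R (fun S T : k.-tuple V => psi S != psi T) (card_tuple_gt0 V0 k).
(* The negation appears because [par g Q == sigma S] is the negated exclusive or of its two
   sides. *)
exists (~~ psi S2).
pose B (u : X) := psi u.1 != psi S2.
have PB : Pr B <= k%:R * (8 * eta).
  rewrite /B (@Pr_fst R _ {: k.+1.-tuple V} (fun S : k.-tuple V => psi S != psi S2));
    last by rewrite card_tuple_gt0.
  exact: le_trans Ppsi.
apply: le_trans (_ : _ <= Pr (fun u => hx u != ps u) + Pr B) _; last by lra.
apply: Pr_union => -[S Q]; rewrite /hx /ps /B /psi /= par_cat.
by case: (h _); case: (sigma _); case: (sigma _); case: (par _ _); case: (par _ _); case: (par _ _).
Qed.

Lemma Pr_par_neq m (g g' : V -> bool) :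
  Pr (fun t : m.-tuple V => par g t != par g' t) <= m%:R * Pr (fun x => g x != g' x).
Proof.
elim: m => [|m IHm].
  by rewrite (Pr_tuple0 _ V0 (fun t => par g t != par g' t)) eqxx mul0r.
rewrite (Pr_tuple_cons _ _ (fun t => par g t != par g' t)).
rewrite -natr1 mulrDl mul1r addrC.
have := @Pr_union R (V * m.-tuple V)%type (fun u => par g (u.1 :: u.2) != par g' (u.1 :: u.2))
  (fun u => g u.1 != g' u.1) (fun u => par g u.2 != par g' u.2).
move=> /(_ _)/le_trans; apply.
  move=> [x t] /=; rewrite !par_cons.
  by case: (g x); case: (g' x); case: (par g t); case: (par g' t).
rewrite (@Pr_fst R _ _ (fun x => g x != g' x)) ?card_tuple_gt0 //.
by rewrite (@Pr_snd R V _ (fun t : m.-tuple V => par g t != par g' t)) // lerD2l.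
Qed.

Lemma Pr_tuple_cat_cons (p : seq V -> bool) :
  Pr (fun u : k.+1.-tuple V * k.+1.-tuple V => p (u.1 ++ u.2)) =
  mean (fun x => Pr (fun t : (k + k.+1).-tuple V => p (x :: t))).
Proof.
rewrite -(Pr_tuple_cat _ _ _ p) -(Pr_pair R (fun x (t : (k + k.+1).-tuple V) => p (x :: t))).
exact: (@Pr_tuple_cons R V (k + k.+1) p).
Qed.

(** [vertex_par] gives each [x] its own corrected colour [g x]. On average over [x] both [g] and
    [g0] predict [h], so they rarely differ, and [g0] can be replaced by [g] on the other entries by
    a union bound. *)
Lemma vertex_stability (eta : R) (g0 : V -> bool) :
    0 <= eta -> eta <= 1 ->
    Pr (fun u : k.+1.-tuple V * k.+1.-tuple V =>
      h (u.1 ++ u.2) != par g0 (u.1 ++ u.2)) <= eta ^+ 2 ->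
    `|1 - 2 * Pr (fun Q : k.+1.-tuple V => par g0 Q)| <= eta ->
    (forall x, 2^-1 - eta <= Pr (fun t : (k + k.+1).-tuple V => h (x :: t))) ->
  exists g, forall x, Pr (fun t : (k + k.+1).-tuple V => h (x :: t) != par g (x :: t))
    <= 16 * k.+1%:R ^+ 2 * eta.
Proof.
move=> eta0 eta1 Hg Hb Hd.
set e5 := (2 * k%:R + 1) * (4 * eta).
have /fin_all_exists[g gP] : forall x, exists c,
    Pr (fun t : (k + k.+1).-tuple V => h (x :: t) != c (+) par g0 t) <= e5.
  move=> x; have [|c cP] := @vertex_par g0 eta x eta0 Hg Hb.
    by have := Hd x; rewrite (Pr_tuple_cat _ _ _ (fun t => h (x :: t))).
  by exists c; rewrite (Pr_tuple_cat _ _ _ (fun t => h (x :: t) != c (+) par g0 t)).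
exists g.
have Pgg : Pr (fun x => g x != g0 x) <= e5 + eta ^+ 2.
  rewrite -(@Pr_fst R _ {: (k + k.+1).-tuple V}) ?card_tuple_gt0 //.
  have := @Pr_union R (V * (k + k.+1).-tuple V)%type (fun u => g u.1 != g0 u.1)
    (fun u => h (u.1 :: u.2) != g u.1 (+) par g0 u.2)
    (fun u => h (u.1 :: u.2) != par g0 (u.1 :: u.2)).
  move=> /(_ _)/le_trans; apply.
    move=> [x t] /=; rewrite par_cons.
    by case: (h _); case: (g x); case: (g0 x); case: (par _ t).
  apply: lerD; last first.
    rewrite (Pr_pair R (fun x (t : (k + k.+1).-tuple V) => h (x :: t) != par g0 (x :: t))).
    by rewrite -(Pr_tuple_cat_cons (fun s => h s != par g0 s)).
  rewrite (Pr_pair R (fun x (t : (k + k.+1).-tuple V) => h (x :: t) != g x (+) par g0 t)).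
  rewrite -[leRHS](@mean_cst R V) //; exact: le_mean.
move=> x.
have := @Pr_union R ((k + k.+1).-tuple V) (fun t => h (x :: t) != par g (x :: t))
  (fun t => h (x :: t) != g x (+) par g0 t) (fun t => par g t != par g0 t).
move=> /(_ _)/le_trans; apply.
  move=> t /=; rewrite par_cons.
  by case: (h _); case: (g x); case: (par _ t); case: (par _ t).
apply: le_trans (lerD (gP x) (@Pr_par_neq (k + k.+1) g g0)) _.
have m0 : 0 <= (k + k.+1)%:R :> R by rewrite ler0n.
apply: le_trans (lerD (lexx e5) (ler_wpM2l m0 Pgg)) _.
have e2 : eta ^+ 2 <= eta by rewrite expr2 ler_piMl.
apply: le_trans (lerD (lexx e5) (ler_wpM2l m0 (lerD (lexx e5) e2))) _.
rewrite /e5 natrD -natr1; have k0 : 0 <= k%:R :> R by rewrite ler0n.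
nra.
Qed.

End Vertex.

(** * Bad edges against missing edges *)
Ltac perm_count :=
  let a := fresh in apply/seq.permP => a;
  rewrite /= ?count_cat /= ?count_cat /= ?count_cat /=; lia.

Section Exchange.
Variables (V : finType) (k : nat) (L : seq V -> bool) (E : seq V).
Hypothesis L_sym : perm_invariant L.
Hypothesis E_size : size E = (k.+1 + k.+1)%N.
Hypothesis L_split : forall s t,
  size s = k.+1 -> size t = k.+1 -> perm_eq (s ++ t) E -> L s || L t.

(** The two members of [L] share the entry [x], and [z] is the one entry of [E] left out by both. *)
Definition crossing_pair := exists (x : V) (p : seq V) (z : V) (q : seq V),
  [/\ size p = k, size q = k, perm_eq (x :: p ++ z :: q) E, L (x :: p) & L (x :: q)].

(* Swapping one vertex [u] of a set of [L] for [v]: either the new set is still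
   in [L], or its complement is, and the latter meets the old set in [u] only. *)
Lemma exchange_step p q r w :
    size p = size q -> size (r ++ p) = k.+1 -> perm_eq (r ++ p ++ q ++ w) E ->
  L (r ++ p) -> crossing_pair \/ L (r ++ q).
Proof.
elim: p q r w => [|u p IHp] [|v q] r w //=; first by right.
move=> [spq] srp prm Lp.
have sz : size (r ++ u :: p ++ v :: q ++ w) = size E := perm_size prm.
move: sz srp; rewrite E_size /= !size_cat /= !size_cat /= ?size_cat => sz srp.
have [Lv | nLv] := boolP (L ((v :: r) ++ p)).
  have s1 : size ((v :: r) ++ p) = k.+1 by rewrite /= size_cat; lia.
  have p1 : perm_eq ((v :: r) ++ p ++ q ++ u :: w) E.
    rewrite -(permPr prm); perm_count.
  have [|H] := IHp q (v :: r) (u :: w) spq s1 p1 Lv; first by left.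
  - right; rewrite (L_sym (t := (v :: r) ++ q)) //.
    perm_count.
left; exists u, (r ++ p), v, (q ++ w); split.
- by rewrite size_cat; lia.
- by rewrite size_cat; lia.
- rewrite -(permPr prm); perm_count.
- rewrite (L_sym (t := r ++ u :: p)) //.
  perm_count.
have := @L_split ((v :: r) ++ p) (u :: q ++ w).
rewrite (negPf nLv) /=; apply; rewrite /= ?size_cat; try lia.
rewrite -(permPr prm); perm_count.
Qed.

(** Start from a half [x :: p] in [L], with other half [z :: q], and exchange [p] for [q] while
    keeping [x]. If no step produces a crossing pair, then [x :: q] is in [L] and crosses
    [x :: p]. *)
Lemma exists_crossing_pair : crossing_pair.
Proof.
have [s [t [ss st st_E Ls]]] : exists s t,
    [/\ size s = k.+1, size t = k.+1, perm_eq (s ++ t) E & L s].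
  have s1 : size (take k.+1 E) = k.+1 by rewrite size_takel // E_size; lia.
  have s2 : size (drop k.+1 E) = k.+1 by rewrite size_drop E_size; lia.
  have := L_split s1 s2; rewrite cat_take_drop perm_refl => /(_ isT)/orP[Ls|Ls].
    by exists (take k.+1 E), (drop k.+1 E); rewrite cat_take_drop.
  by exists (drop k.+1 E), (take k.+1 E); rewrite perm_catC cat_take_drop.
case: s t ss st st_E Ls => [//|x p] [//|z q] [sp] [sq] prm Lp.
have := @exchange_step p q [:: x] [:: z]; rewrite sp sq /= sp => /(_ erefl erefl).
case=> //.
- rewrite -(permPr prm); perm_count.
- by move=> Lq; exists x, p, z, q.
Qed.

End Exchange.

(** * Heavy tuples, and bad edges counted through crossing pairs *)

Section BadMissing.
Variables (R : realFieldType) (V : finType).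
Hypothesis V0 : (0 < #|V|)%N.
Local Notation Pr := (@Pr R _).

Lemma Pr_mem (s : seq V) : Pr (fun x => x \in s) <= (size s)%:R / #|V|%:R.
Proof.
rewrite ler_pdivlMr ?ltr0n // Pr_card // ler_nat.
by rewrite (@eq_card _ _ (mem s)) ?card_size // => x; rewrite !inE.
Qed.

Lemma Pr_nuniq_cat m (s : seq V) : uniq s ->
  Pr (fun t : m.-tuple V => ~~ uniq (s ++ t)) <= (m * (size s + m))%:R / #|V|%:R.
Proof.
elim: m s => [|m IHm] s us.
  by rewrite (Pr_tuple0 _ V0 (fun t => ~~ uniq (s ++ t))) cats0 us mul0n mul0r.
rewrite (Pr_tuple_cons _ _ (fun t => ~~ uniq (s ++ t))).
have := @Pr_union R (V * m.-tuple V)%type (fun u => ~~ uniq (s ++ u.1 :: u.2))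
  (fun u => u.1 \in s) (fun u => (u.1 \notin s) && ~~ uniq (s ++ u.1 :: u.2)).
move=> /(_ _)/le_trans; apply; first by move=> [x t] /=; case: (x \in s).
rewrite (@Pr_fst R _ _ (fun x => x \in s)) ?card_tuple_gt0 //.
rewrite (Pr_pair R (fun x (t : m.-tuple V) => (x \notin s) && ~~ uniq (s ++ x :: t))).
apply: le_trans (_ : _ <= (size s)%:R / #|V|%:R + (m * (size s + m.+1))%:R / #|V|%:R) _.
  apply: lerD; first exact: Pr_mem.
  rewrite -[leRHS](@mean_cst R V) //; apply: le_mean => x.
  case xs: (x \in s) => /=.
    by rewrite /Pr mean_cst ?card_tuple_gt0 // divr_ge0 ?ler0n.
  have := IHm (rcons s x); rewrite rcons_uniq xs us => /(_ isT); rewrite size_rcons addSnnS.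
  apply: le_trans; rewrite le_eqVlt; apply/orP; left; apply/eqP.
  by apply: eq_Pr => t; rewrite cat_rcons.
rewrite -mulrDl -natrD ler_pM2r ?invr_gt0 ?ltr0n // ler_nat; lia.
Qed.

Variables (k : nat) (h : seq V -> bool) (g : V -> bool) (e : R).
Hypothesis h_sym : perm_invariant h.
Hypothesis h_uniq : forall s, h s -> uniq s.
Hypothesis h_tf : forall P Q S : k.+1.-tuple V,
  h (P ++ Q) -> h (P ++ S) -> h (Q ++ S) -> False.
Hypothesis g_vertex : forall x,
  Pr (fun t : (k + k.+1).-tuple V => h (x :: t) != par g (x :: t)) <= e.
Hypothesis g_bal : `|1 - 2 * Pr (fun Q : k.+1.-tuple V => par g Q)| <= 4^-1.
Hypothesis V_large : (k.+1 * (k.+1 + k.+1 + k.+1))%:R / #|V|%:R <= 8^-1 :> R.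

Definition miss s := [&& uniq s, par g s & ~~ h s].
Definition missdeg P := Pr (fun S : k.+1.-tuple V => miss (P ++ S)).
Definition heavy P := 8^-1 <= missdeg P.

Lemma miss_sym : perm_invariant miss.
Proof.
by move=> s t st; rewrite /miss (perm_uniq st) (par_sym _ st) (h_sym st).
Qed.

Lemma heavy_sym : perm_invariant heavy.
Proof.
move=> s t st; congr (_ <= _); apply: eq_Pr => S.
by apply: miss_sym; rewrite perm_cat2r.
Qed.

(** Triangle-freeness forbids [P ++ S] and [Q ++ S] from both being edges; when [S] has the opposite
    parity and no entry repeats, the absent one is missing. Such [S] have measure at least 3/8 -
    1/8, so one missing degree reaches the threshold 1/8. *)
Lemma heavy_split (P Q : k.+1.-tuple V) :
  h (P ++ Q) -> ~~ par g (P ++ Q) -> heavy P || heavy Q.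
Proof.
move=> hPQ pPQ; pose b := par g P.
have pQ : par g Q = b by move: pPQ; rewrite par_cat /b; case: (par g P); case: par.
have big : 3 / 8 <= Pr (fun S : k.+1.-tuple V => par g S != b).
  move: g_bal; rewrite ler_norml => /andP[b1 b2]; case: b {pQ}.
    rewrite (@eq_Pr _ _ _ (fun Q : k.+1.-tuple V => ~~ par g Q)); last by move=> S; case: par.
    by rewrite PrC ?card_tuple_gt0 //; lra.
  rewrite (@eq_Pr _ _ _ (fun Q : k.+1.-tuple V => par g Q)); last by move=> S; case: par.
  by lra.
have nu : Pr (fun S : k.+1.-tuple V => ~~ uniq ((P ++ Q) ++ S)) <= 8^-1.
  by apply: le_trans (Pr_nuniq_cat _ (h_uniq hPQ)) _; rewrite size_cat !size_tuple.
have : Pr (fun S : k.+1.-tuple V => par g S != b) <=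
    (missdeg P + missdeg Q) + Pr (fun S : k.+1.-tuple V => ~~ uniq ((P ++ Q) ++ S)).
  rewrite -!meanD; apply: le_mean => S; rewrite -!natrD ler_nat.
  case: eqP => // /eqP pS; case uPQS : (uniq ((P ++ Q) ++ S)) => /=; last by rewrite addn1.
  rewrite addn0 /miss !par_cat -/b pQ.
  have -> : uniq (P ++ S).
    by move: uPQS; rewrite -catA uniq_catCA cat_uniq => /and3P[].
  have -> : uniq (Q ++ S) by move: uPQS; rewrite -catA cat_uniq => /and3P[].
  have -> /= : b (+) par g S by rewrite -negb_eqb eq_sym.
  case E1: (h (P ++ S)) => //; case E2: (h (Q ++ S)) => //.
  by case: (h_tf hPQ E1 E2).
move=> H; case: (leP 8^-1 (missdeg P)) => [|c1]; first by rewrite /heavy => ->.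
apply/orP; right; rewrite /heavy; lra.
Qed.

(** Markov's inequality: each heavy [x :: S] extends to a missing tuple with probability at least
    1/8. *)
Lemma heavy_vertex x : Pr (fun S : k.-tuple V => heavy (x :: S)) <= 8 * e.
Proof.
have H : Pr (fun t : (k + k.+1).-tuple V => miss (x :: t)) <= e.
  apply: le_trans (g_vertex x); apply: le_Pr => t.
  by rewrite /miss => /and3P[_ -> /negPf->].
suff : 8^-1 * Pr (fun S : k.-tuple V => heavy (x :: S)) <= e by lra.
apply: le_trans H; rewrite (Pr_tuple_cat _ _ _ (fun t => miss (x :: t))).
rewrite (Pr_pair R (fun (S : k.-tuple V) (T : k.+1.-tuple V) => miss (x :: S ++ T))).
rewrite -meanZ; apply: le_mean => S; rewrite -/(missdeg (x :: S)).
case c: (heavy (x :: S)); first by rewrite mulr1; apply: c.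
by rewrite mulr0; apply: Pr_ge0.
Qed.

Lemma Pr_heavy :
  Pr (fun P : k.+1.-tuple V => heavy P) <=
  8 * Pr (fun t : (k.+1 + k.+1).-tuple V => miss t).
Proof.
suff : 8^-1 * Pr (fun P : k.+1.-tuple V => heavy P) <=
  Pr (fun t : (k.+1 + k.+1).-tuple V => miss t) by lra.
rewrite (Pr_tuple_cat _ _ _ miss).
rewrite (Pr_pair R (fun S T : k.+1.-tuple V => miss (S ++ T))).
rewrite -meanZ; apply: le_mean => S; rewrite -/(missdeg S).
case c: (heavy S); first by rewrite mulr1; apply: c.
by rewrite mulr0; apply: Pr_ge0.
Qed.

(** For [s = x :: p ++ z :: q] the two sequences are [x :: p] and [x :: q]; dropping [k.+2] entries
    skips [z]. *)
Definition crossing (s : seq V) :=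
  heavy (take k.+1 s) && heavy (take 1 s ++ drop k.+2 s).

(** First [x :: p] is heavy, with probability at most 8 times that of a missing tuple. Given [x] and
    [p], the independent [q] makes [x :: q] heavy with probability at most [8 * e]. *)
Lemma Pr_crossing :
  Pr (fun t : (k.+1 + k.+1).-tuple V => crossing t) <=
  64 * e * Pr (fun t : (k.+1 + k.+1).-tuple V => miss t).
Proof.
have e0 : 0 <= e.
  by have /card_gt0P[x _] := V0; apply: le_trans (g_vertex x); apply: Pr_ge0.
rewrite (Pr_tuple_cat _ _ _ crossing).
rewrite (Pr_cons2 _ _ _ (fun s t => crossing (s ++ t))).
rewrite (@eq_Pr _ _ _ (fun u : (V * k.-tuple V) * (V * k.-tuple V) =>
  heavy (u.1.1 :: u.1.2) && heavy (u.1.1 :: u.2.2))); last first.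
  move=> [[x p] [z q]]; rewrite /crossing /= take0.
  by rewrite take_size_cat ?size_tuple // -cat_rcons drop_size_cat
    ?size_rcons ?size_tuple.
rewrite (Pr_pair R (fun (u v : V * k.-tuple V) => heavy (u.1 :: u.2) && heavy (u.1 :: v.2))).
apply: le_trans (_ : _ <= Pr (fun u : V * k.-tuple V => heavy (u.1 :: u.2)) * (8 * e)) _.
  rewrite -meanZr; apply: le_mean => -[x p] /=.
  case: (heavy (x :: p)) => /=; last by rewrite mul0r /Pr mean_cst // card_pair_gt0 ?card_tuple_gt0.
  rewrite mul1r (@Pr_snd R V _ (fun q : k.-tuple V => heavy (x :: q))) //.
  exact: heavy_vertex.
have := Pr_heavy; rewrite (Pr_tuple_cons _ _ heavy) => H.
by apply: le_trans (ler_wpM2r _ H) _; lra.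
Qed.

Lemma exists_crossing (E : seq V) :
    size E = (k.+1 + k.+1)%N -> h E -> ~~ par g E ->
  exists2 t : (k.+1 + k.+1).-tuple V, perm_eq t E & crossing t.
Proof.
move=> sE hE pE.
have [|x [p [z [q [sp sq prm Lp Lq]]]]] := @exists_crossing_pair V k heavy E heavy_sym sE.
  move=> s t ss st prm.
  have := @heavy_split (tcast ss (in_tuple s)) (tcast st (in_tuple t)).
  by rewrite !val_tcast /= (h_sym prm) (par_sym _ prm); apply.
have sz : size (x :: p ++ z :: q) == (k.+1 + k.+1)%N by rewrite (perm_size prm) sE.
exists (Tuple sz) => //; rewrite /crossing /= take0 take_size_cat // Lp /=.
by rewrite -cat_rcons drop_size_cat ?size_rcons ?sp.
Qed.

End BadMissing.

(** * Set families as predicates on tuples *)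
Section Families.
Variables (R : realFieldType) (V : finType).
Hypothesis V0 : (0 < #|V|)%N.
Local Notation Pr := (@Pr R _).

Lemma set_seq_card_uniq (t : seq V) : (#|[set x in t]| == size t) = uniq t.
Proof. by rewrite cardsE; apply/eqP/card_uniqP. Qed.

Lemma card_orderings m (E : {set V}) : #|E| = m ->
  #|[pred t : m.-tuple V | [set x in t] == E]| = m`!.
Proof.
move=> cE; have -> : m`! = #|E| ^_ m by rewrite cE ffactnn.
rewrite -(card_uniq_tuples m (mem E)).
apply: eq_card => t; rewrite !inE; apply/eqP/andP => [tE|[/allP tE ut]].
  split; first by apply/allP => x xt; rewrite /= -tE inE.
  by rewrite -set_seq_card_uniq tE cE size_tuple.
apply/eqP; rewrite eqEcard; apply/andP; split.
  by apply/subsetP => x; rewrite inE => /tE.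
by move: ut; rewrite -set_seq_card_uniq => /eqP->; rewrite cE size_tuple.
Qed.

(** Each member of [A] is the support of exactly [m]! tuples; a tuple with a repeated entry has too
    small a support. *)
Lemma Pr_family m (A : {set {set V}}) : (forall E, E \in A -> #|E| = m) ->
  Pr (fun t : m.-tuple V => [set x in t] \in A) * (#|V| ^ m)%:R = (m`! * #|A|)%:R.
Proof.
move=> Am; rewrite -card_tuple Pr_card ?card_tuple_gt0 //; congr (_%:R).
rewrite -[LHS]sum1_card (partition_big (fun t : m.-tuple V => [set x in t])
  (fun E => E \in A)) //=.
rewrite mulnC -sum_nat_const; apply: eq_bigr => E EA.
rewrite -(card_orderings (Am E EA)) -sum1_card; apply: eq_bigl => t; rewrite !inE.
by case: eqP => [->|]; rewrite ?EA ?andbF.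
Qed.

Lemma Pr_link m x (A : {set {set V}}) :
    (forall E, E \in A -> #|E| = m.+1 /\ x \in E) ->
  Pr (fun t : m.-tuple V => uniq (x :: t) && ([set y in x :: t] \in A)) * (#|V| ^ m)%:R
    = (m`! * #|A|)%:R.
Proof.
move=> Am; have cA : #|[set E :\ x | E in A]| = #|A|.
  apply: card_in_imset => E F EA FA eEF.
  by rewrite -(setD1K (Am E EA).2) -(setD1K (Am F FA).2) eEF.
rewrite -cA -Pr_family => [|_ /imsetP[E /Am[cE xE] ->]]; last first.
  by apply/eqP; rewrite -eqSS -cE (cardsD1 x E) xE.
congr (_ * _); apply: eq_Pr => t; apply/andP/imsetP => [[/= /andP[xt ut] tA]|[E EA tE]].
  exists [set y in x :: t] => //; apply/setP => y; rewrite !inE.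
  by case: eqP => // -> /=; rewrite (negPf xt).
have [cE xE] := Am E EA.
have tE' : [set y in x :: t] = E.
  by rewrite -(setD1K xE) -tE; apply/setP => y; rewrite !inE.
by rewrite -set_seq_card_uniq tE' cE /= size_tuple eqxx EA.
Qed.

Definition odd_family m (g : V -> bool) : {set {set V}} :=
  [set E : {set V} | (#|E| == m) && odd #|[set x in E | g x]|].

Lemma odd_family_seq m g (t : seq V) : size t = m ->
  ([set x in t] \in odd_family m g) = uniq t && par g t.
Proof.
move=> st; rewrite inE -st set_seq_card_uniq; case ut: (uniq t) => //=.
congr odd; rewrite -size_filter -(card_uniqP (filter_uniq g ut)).
by apply: eq_card => x; rewrite !inE mem_filter andbC.
Qed.

(** The left side is the expectation of [(-1) ^ par g t], which is multiplicative over independent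
    entries. *)
Lemma Pr_par_bias m (g : V -> bool) :
  1 - 2 * Pr (fun t : m.-tuple V => par g t) = (1 - 2 * Pr g) ^+ m.
Proof.
elim: m => [|m IHm]; first by rewrite (Pr_tuple0 _ V0 (par g)) mulr0 subr0.
rewrite (Pr_tuple_cons _ _ (par g)) exprS -IHm.
rewrite (@eq_Pr _ _ _ (fun u : V * m.-tuple V => g u.1 (+) par g u.2)); last first.
  by move=> u; rewrite par_cons.
rewrite (Pr_addb R g (fun t : m.-tuple V => par g t)) ?card_tuple_gt0 //; ring.
Qed.

Lemma Pr_par_cat m (g : V -> bool) :
  Pr (fun t : (m + m).-tuple V => par g t) =
  2^-1 - (1 - 2 * Pr (fun t : m.-tuple V => par g t)) ^+ 2 / 2.
Proof.
rewrite (Pr_tuple_cat _ _ _ (par g)).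
rewrite (@eq_Pr _ _ _ (fun u : m.-tuple V * m.-tuple V => par g u.1 (+) par g u.2)); last first.
  by move=> u; rewrite par_cat.
rewrite (@Pr_neq_prod R _ (fun t : m.-tuple V => par g t)) ?card_tuple_gt0 //.
by field.
Qed.

End Families.

(** * Cloning a vertex *)
Section Clone.
Variables (n k : nat) (H : {set {set 'I_n}}) (x y : 'I_n).

(** The edges at [x] are discarded and [x] becomes a twin of [y]: a set with [x] and without [y] is
    kept exactly when putting [y] for [x] gives an edge of [H]. *)
Definition clone : {set {set 'I_n}} :=
  [set E : {set 'I_n} | if x \in E then (y \notin E) && (tperm x y @: E \in H) else E \in H].

Lemma tperm_imset_id (E : {set 'I_n}) : x \notin E -> y \notin E -> tperm x y @: E = E.
Proof.
move=> xE yE; rewrite -[RHS]imset_id; apply: eq_in_imset => z zE.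
by rewrite tpermD //; [apply: contraNneq xE => -> | apply: contraNneq yE => ->].
Qed.

Lemma clone_uniform m : uniform m H -> uniform m clone.
Proof.
move=> Hm E; rewrite inE; case: ifP => _; last exact: Hm.
by move=> /andP[_ /Hm <-]; rewrite card_imset //; apply: perm_inj.
Qed.

(* Any two vertices of a copy of C3 lie in a common edge, and no edge of the
   clone contains both [x] and [y]. *)
Lemma clone_C3_free : ~ has_C3 k H -> ~ has_C3 k clone.
Proof.
move=> nH [P1 [P2 [P3 [[c1 c2 c3] [[d12 d13 d23] [e12 e13 e23]]]]]].
apply: nH; have [xP|xP] := boolP (x \in P1 :|: P2 :|: P3); last first.
  move: xP; rewrite !inE !negb_or => /andP[/andP[x1 x2] x3].
  exists P1, P2, P3; move: e12 e13 e23.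
  by rewrite !inE (negPf x1) (negPf x2) (negPf x3) /= => -> -> ->.
have [y1 y2 y3] : [/\ y \notin P1, y \notin P2 & y \notin P3].
  move: xP e12 e13 e23; rewrite !inE.
  case: (x \in P1); case: (x \in P2); case: (x \in P3) => //= _;
  case: (y \in P1); case: (y \in P2); case: (y \in P3) => //=;
  by rewrite ?andbF.
have tH (P Q : {set 'I_n}) : P :|: Q \in clone -> y \notin P -> y \notin Q ->
    tperm x y @: P :|: tperm x y @: Q \in H.
  move=> + yP yQ; rewrite -imsetU inE; case: ifPn => [_ /andP[]//|xPQ PQ].
  by rewrite tperm_imset_id // inE negb_or yP.
have tI : injective (tperm x y) by apply: perm_inj.
have dI (P Q : {set 'I_n}) : [disjoint P & Q] -> [disjoint tperm x y @: P & tperm x y @: Q].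
  by rewrite -!setI_eq0 -imsetI => [/eqP->|? ? ? ?]; [rewrite imset0 | apply: tI].
exists (tperm x y @: P1), (tperm x y @: P2), (tperm x y @: P3).
rewrite !card_imset //; split=> //; split; split; try exact: dI; exact: tH.
Qed.

(** The clone contains the edges of [H] avoiding [x] and, disjoint from these, a copy of every edge
    through [y] avoiding [x]. Only the edges through [x] were lost. *)
Lemma clone_degree : (#|clone| <= #|H|)%N ->
  (#|[set E in H | (y \in E) && (x \notin E)]| <= #|[set E in H | x \in E]|)%N.
Proof.
have tI : injective (tperm x y) by apply: perm_inj.
have tx (F : {set 'I_n}) : (x \in tperm x y @: F) = (y \in F).
  by rewrite -{1}(tpermR x y) mem_imset.
have ty (F : {set 'I_n}) : (y \in tperm x y @: F) = (x \in F).
  by rewrite -{1}(tpermL x y) mem_imset.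
move=> cH; set Hy := [set E in H | _ && _]; set Hx := [set E in H | x \in E].
rewrite -(leq_add2r #|H :\: Hx|).
have -> : (#|Hx| + #|H :\: Hx|)%N = #|H|.
  rewrite -(cardsID Hx H) /Hx; congr (_ + _)%N; apply: eq_card => E.
  by rewrite !inE; case: (E \in H).
apply: leq_trans cH; rewrite -(card_imset Hy (imset_inj tI)).
rewrite -cardsUI -[leqRHS]addn0; apply: leq_add; last first.
  rewrite leqn0 cards_eq0 -subset0; apply/subsetP => E; rewrite !inE.
  move=> /andP[/imsetP[F]]; rewrite inE => /and3P[FH yF xF] ->.
  rewrite tx yF andbT.
  by move=> /andP[/negP nH tH].
apply: subset_leq_card; apply/subsetP => E; rewrite !inE => /orP[].
  move=> /imsetP[F]; rewrite inE => /and3P[FH yF xF] ->.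
  rewrite tx ty yF xF /=.
  have -> // : tperm x y @: (tperm x y @: F) = F.
  by rewrite -imset_comp -[RHS]imset_id; apply: eq_imset => z /=; rewrite tpermK.
by case: (x \in E) => [/andP[/negP nE EH]|/andP[]//]; rewrite EH in nE.
Qed.

End Clone.

(** * The hypergraphs B(n,t) *)
Lemma hiso_card n (H G : {set {set 'I_n}}) : hiso H G -> #|H| = #|G|.
Proof. by case=> s ->; rewrite card_imset //; apply/imset_inj/perm_inj. Qed.

(** The permutation lists [A] first and then its complement. *)
Lemma exists_perm_prefix n (A : {set 'I_n}) :
  exists s : {perm 'I_n}, forall i, (s i \in A) = (i < #|A|)%N.
Proof.
pose r := enum A ++ enum (~: A).
have sr : size r = n by rewrite size_cat -!cardE cardsC card_ord.
have ur : uniq r.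
  rewrite cat_uniq !enum_uniq /= andbT; apply/hasPn => z.
  by rewrite !mem_enum inE.
have fI : injective (fun i => nth i r i).
  move=> i j /=; rewrite (set_nth_default j) ?sr // => /eqP.
  by rewrite nth_uniq ?sr // => /eqP/val_inj.
exists (perm fI) => i; rewrite permE nth_cat -cardE.
case: ltnP => iA; first by rewrite -mem_enum mem_nth // -cardE.
suff : nth i (enum (~: A)) (i - #|A|) \in enum (~: A).
  by rewrite mem_enum inE => /negPf.
by rewrite mem_nth // -cardE; have := cardsC A; rewrite card_ord; have := ltn_ord i; lia.
Qed.

Lemma hiso_odd_family n k (g : 'I_n -> bool) :
  exists2 a, (a <= n)%N & hiso (odd_family (2 * k)%N g) (Bhyp n k a).
Proof.
pose A := [set i | g i].
have [s sA] := exists_perm_prefix A.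
exists #|A|; first by rewrite -[leqRHS]card_ord max_card.
have sI : injective s by apply: perm_inj.
have key e : (e \in Bhyp n k #|A|) = (s @: e \in odd_family (2 * k)%N g).
  rewrite !inE card_imset //; case: eqP => //= ce.
  have -> : [set x in s @: e | g x] = s @: (e :&: V1 n #|A|).
    apply/setP => z; rewrite !inE; apply/andP/imsetP => [[/imsetP[u ue ->] gu]|[u]].
      by exists u => //; rewrite !inE ue -sA inE.
    by rewrite !inE -sA inE => /andP[ue gu] ->; rewrite imset_f.
  (* As [2 * k] is even, the intersections with the two parts have equal parity. *)
  rewrite card_imset //; have := cardsID (V1 n #|A|) e; rewrite ce setDE => E.
  by have := congr1 odd E; rewrite oddD oddM /=; case: odd; case: odd.
exists s; apply/setP => E; apply/idP/imsetP => [EO|[e eB ->]]; last by rewrite -key.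
have sE : s @: (s @^-1: E) = E.
  apply/setP => z; apply/imsetP/idP => [[u]|zE]; first by rewrite inE => uE ->.
  by exists (s^-1%g z); rewrite ?inE permKV.
by exists (s @^-1: E) => //; rewrite key sE.
Qed.

Lemma card_odd_family_le n k (g : 'I_n -> bool) : (#|odd_family (2 * k) g| <= bmax n k)%N.
Proof.
have [a an iso] := hiso_odd_family k g; rewrite (hiso_card iso) /bmax.
exact: (leq_bigmax (F := fun b : 'I_n.+1 => #|Bhyp n k b|) (Ordinal (an : (a < n.+1)%N))).
Qed.

(** * Extremal hypergraphs *)
(** A boolean form of [has_C3], which allows a largest C3-free family to be chosen by
    [arg_maxnP]. *)
Definition has_C3b n k (H : {set {set 'I_n}}) :=
  [exists P : {set 'I_n} * {set 'I_n} * {set 'I_n},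
    [&& [&& #|P.1.1| == k, #|P.1.2| == k & #|P.2| == k],
        [&& [disjoint P.1.1 & P.1.2], [disjoint P.1.1 & P.2] & [disjoint P.1.2 & P.2]]
      & [&& P.1.1 :|: P.1.2 \in H, P.1.1 :|: P.2 \in H & P.1.2 :|: P.2 \in H]]].

Lemma has_C3P n k (H : {set {set 'I_n}}) : reflect (has_C3 k H) (has_C3b k H).
Proof.
apply: (iffP existsP) => [[[[P1 P2] P3] /=]|[P1 [P2 [P3 [[c1 c2 c3] [[d1 d2 d3] [e1 e2 e3]]]]]]].
  move=> /and3P[/and3P[/eqP c1 /eqP c2 /eqP c3] /and3P[d1 d2 d3] /and3P[e1 e2 e3]].
  by exists P1, P2, P3.
by exists (P1, P2, P3); rewrite /= c1 c2 c3 !eqxx d1 d2 d3 e1 e2 e3.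
Qed.

Lemma exists_extremal n k m (H : {set {set 'I_n}}) : uniform m H -> ~ has_C3 k H ->
  exists G : {set {set 'I_n}}, [/\ uniform m G, ~ has_C3 k G &
    forall F : {set {set 'I_n}}, uniform m F -> ~ has_C3 k F -> (#|F| <= #|G|)%N].
Proof.
pose good (G : {set {set 'I_n}}) := [forall E in G, #|E| == m] && ~~ has_C3b k G.
have goodP (G : {set {set 'I_n}}) : reflect (uniform m G /\ ~ has_C3 k G) (good G).
  apply: (iffP andP) => -[Gu Gf]; split.
  - by move=> E /(forall_inP Gu)/eqP.
  - by move=> /has_C3P; apply/negP.
  - by apply/forall_inP => E /Gu/eqP.
  - by apply/negP => /has_C3P.
move=> Hu Hf; have goodH : good H by apply/goodP.
case: (@arg_maxnP _ H good (fun G => #|G|) goodH) => G /goodP[Gu Gf] Gm.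
by exists G; split=> // F Fu Ff; apply: Gm; apply/goodP.
Qed.

(** The second hypothesis gives [#|B :\: A| <= #|A :\: B|], so with the first both differences are
    empty. *)
Lemma eq_of_card_setD (T : finType) (A B : {set T}) :
  (2 * #|A :\: B| <= #|B :\: A|)%N -> (#|B| <= #|A|)%N -> A = B.
Proof.
move=> AB BA; have cA := cardsID B A; have cB := cardsID A B; rewrite setIC in cB.
apply/eqP; rewrite eqEsubset -!setD_eq0 -!cards_eq0.
by apply/andP; split; apply/eqP; lia.
Qed.

(** * Structure of a largest C3-free hypergraph with at least [bmax] edges *)

Section Extremal.
Variables (R : realFieldType) (n k : nat) (H : {set {set 'I_n}}).
Hypothesis n0 : (0 < n)%N.
Local Notation Pr := (@Pr R _).
Local Notation K := (k.+1 + k.+1)%N.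
Hypothesis H_unif : uniform K H.
Hypothesis H_free : ~ has_C3 k.+1 H.
Hypothesis H_max : forall G : {set {set 'I_n}},
  uniform K G -> ~ has_C3 k.+1 G -> (#|G| <= #|H|)%N.
Hypothesis H_bmax : (bmax n k.+1 <= #|H|)%N.

Let V0 : (0 < #|'I_n|)%N. Proof. by rewrite card_ord. Qed.

Definition edge (s : seq 'I_n) := uniq s && ([set x in s] \in H).

Lemma edge_sym : perm_invariant edge.
Proof.
move=> s t st; rewrite /edge (perm_uniq st).
by have -> : [set x in s] = [set x in t] by apply/setP => x; rewrite !inE (perm_mem st).
Qed.

Lemma edge_uniq s : edge s -> uniq s.
Proof. by case/andP. Qed.

Lemma edge_size s : size s = K -> edge s = ([set x in s] \in H).
Proof.
move=> ss; rewrite /edge -set_seq_card_uniq ss andbC.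
by case sH: (_ \in H) => //=; rewrite (H_unif sH) eqxx.
Qed.

Lemma edge_free (P Q S : k.+1.-tuple 'I_n) :
  edge (P ++ Q) -> edge (P ++ S) -> edge (Q ++ S) -> False.
Proof.
have setU (s t : seq 'I_n) : [set x in s ++ t] = [set x in s] :|: [set x in t].
  by apply/setP => x; rewrite !inE mem_cat.
have dis (s t : seq 'I_n) : uniq (s ++ t) -> [disjoint [set x in s] & [set x in t]].
  rewrite cat_uniq => /and3P[_ /hasPn st _]; rewrite disjoint_subset.
  by apply/subsetP => x; rewrite !inE => xs; apply/negP => /st; rewrite /= xs.
have card (s : k.+1.-tuple 'I_n) : uniq s -> #|[set x in s]| = k.+1.
  by rewrite -set_seq_card_uniq size_tuple => /eqP.
move=> /andP[uPQ hPQ] /andP[uPS hPS] /andP[uQS hQS]; apply: H_free.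
exists [set x in P], [set x in Q], [set x in S]; rewrite -!setU !dis // !card //.
- by move: uPS; rewrite cat_uniq => /and3P[].
- by move: uPQ; rewrite cat_uniq => /and3P[].
- by move: uPQ; rewrite cat_uniq => /and3P[].
Qed.

Lemma Pr_edge : Pr (fun t : K.-tuple 'I_n => edge t) * (n ^ K)%:R = (K`! * #|H|)%:R.
Proof.
rewrite -(Pr_family R V0 H_unif) card_ord; congr (_ * _).
by apply: eq_Pr => t; rewrite edge_size ?size_tuple.
Qed.

(** Turning [x] into a clone of [y] cannot gain edges, so [x] lies in at least as many edges as
    there are through [y] avoiding [x]. Averaging over [y] gives the edge density; the error
    accounts for tuples containing [x]. *)
Lemma edge_degree x :
  Pr (fun t : K.-tuple 'I_n => edge t) - (K * K)%:R / n%:R <=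
  Pr (fun t : (k + k.+1).-tuple 'I_n => edge (x :: t)).
Proof.
rewrite (Pr_tuple_cat _ _ _ edge) Pr_tuple_cat_cons lerBlDr.
rewrite -[leRHS](@mean_cst R 'I_n) //; apply: le_mean => y.
have [->|yx] := eqVneq y x; first by rewrite lerDl divr_ge0 ?ler0n.
have := @Pr_union R ((k + k.+1).-tuple 'I_n) (fun t => edge (y :: t))
  (fun t => edge (y :: t) && (x \notin t)) (fun t => ~~ uniq ([:: x] ++ t)).
move=> /(_ _)/le_trans; apply.
  by move=> t -> /=; case: (x \in t).
apply: lerD; last first.
  apply: le_trans (Pr_nuniq_cat R V0 _ _) _ => //.
  by rewrite card_ord ler_pM2r ?invr_gt0 ?ltr0n // ler_nat leq_mul //=; lia.
have pn : 0 < (#|'I_n| ^ (k + k.+1))%:R :> R by rewrite ltr0n expn_gt0 V0.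
rewrite -(ler_pM2r pn).
have := @Pr_link R _ V0 (k + k.+1) x [set E in H | x \in E].
have := @Pr_link R _ V0 (k + k.+1) y [set E in H | (y \in E) && (x \notin E)].
move=> /(_ _) E1 /(_ _) E2.
rewrite [X in X * _ <= _](@eq_Pr _ _ _ (fun t : (k + k.+1).-tuple 'I_n => uniq (y :: t) &&
  ([set z in y :: t] \in [set E in H | (y \in E) && (x \notin E)]))); last first.
  move=> t; rewrite /edge !inE /= eqxx /= (negPf _ : (x == y) = false) /=; last by rewrite eq_sym.
  by rewrite -!andbA.
rewrite E1; last by move=> E; rewrite inE => /and3P[/H_unif].
rewrite [X in _ <= X * _](@eq_Pr _ _ _ (fun t : (k + k.+1).-tuple 'I_n => uniq (x :: t) &&
  ([set z in x :: t] \in [set E in H | x \in E]))); last first.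
  by move=> t; rewrite /edge !inE /= eqxx andbT.
rewrite E2; last by move=> E; rewrite inE => /andP[/H_unif].
rewrite ler_nat leq_mul2l; apply/orP; right.
apply: clone_degree; apply: H_max; first exact: clone_uniform.
by apply: clone_C3_free => //; rewrite eq_sym.
Qed.

Lemma card_ord_lt m : (m <= n)%N -> #|[pred i : 'I_n | (i < m)%N]| = m.
Proof.
move=> mn; rewrite -sum1_card (eq_bigl (fun i : 'I_n => (i < m)%N)) //.
by rewrite (big_ord_narrow mn) sum1_card card_ord.
Qed.

(** [H] has at least as many edges as the odd family of a near-halving of the vertices. The term
    [K * K] pays for repeated entries, the 1 for the imbalance of the halves when [n] is odd. *)
Lemma edge_density :
  2^-1 - (1 + K * K)%:R / n%:R <= Pr (fun t : K.-tuple 'I_n => edge t).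
Proof.
pose g (i : 'I_n) := (i < n./2)%N.
have nR : 0 < n%:R :> R by rewrite ltr0n.
pose z : R := 1 - 2 * Pr g.
have zn : z * n%:R = n%:R - 2 * n./2%:R.
  have h2 : (n./2 <= n)%N by lia.
  have := @Pr_card R _ g V0; rewrite card_ord (card_ord_lt h2) => <-.
  by rewrite /z; ring.
have nh : n%:R = 2 * n./2%:R + (odd n)%:R :> R.
  by rewrite -{1}(odd_double_half n) natrD -mul2n natrM addrC.
have o0 : 0 <= (odd n)%:R :> R by rewrite ler0n.
have o1 : (odd n)%:R <= 1 :> R by rewrite lern1 leq_b1.
have z0 : 0 <= z by rewrite -(pmulr_lge0 _ nR) zn; lra.
have z1 : z <= n%:R^-1.
  by rewrite -(ler_pM2r nR) mulVf ?gt_eqF // zn; lra.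
have z2 : z <= 1 by apply: le_trans z1 _; rewrite invf_le1 // ler1n.
have Pg : 2^-1 - n%:R^-1 <= Pr (fun t : K.-tuple 'I_n => par g t).
  rewrite Pr_par_cat // Pr_par_bias // -/z.
  have b0 : 0 <= z ^+ k.+1 by rewrite exprn_ge0.
  have b1 : z ^+ k.+1 <= z by rewrite exprS ler_piMr // exprn_ile1.
  by nra.
have Pnu : Pr (fun t : K.-tuple 'I_n => ~~ uniq t) <= (K * K)%:R / n%:R.
  by have := @Pr_nuniq_cat R _ V0 K [::] isT; rewrite card_ord.
have Pu : Pr (fun t : K.-tuple 'I_n => uniq t && par g t) <= Pr (fun t : K.-tuple 'I_n => edge t).
  have pn : 0 < (n ^ K)%:R :> R by rewrite ltr0n expn_gt0 n0.
  rewrite -(ler_pM2r pn) Pr_edge.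
  rewrite (@eq_Pr _ _ _ (fun t : K.-tuple 'I_n => [set x in t] \in odd_family K g)); last first.
    by move=> t; rewrite odd_family_seq ?size_tuple.
  have := @Pr_family R _ V0 K (odd_family K g); rewrite card_ord => -> => [|E]; last first.
    by rewrite inE => /andP[/eqP].
  rewrite ler_nat leq_mul2l; apply/orP; right; apply: leq_trans H_bmax.
  by have := card_odd_family_le k.+1 g; rewrite mul2n -addnn.
have := @Pr_union R (K.-tuple 'I_n) (fun t => par g t) (fun t => uniq t && par g t)
  (fun t => ~~ uniq t).
move=> /(_ _) U; have {}U : Pr (fun t : K.-tuple 'I_n => par g t) <=
  Pr (fun t : K.-tuple 'I_n => uniq t && par g t) + Pr (fun t : K.-tuple 'I_n => ~~ uniq t).
  by apply: U => t ->; case: uniq.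
rewrite natrD mulrDl mul1r; lra.
Qed.

(** Odd [K]-tuples have density 1/2 minus half the squared bias of [k.+1]-tuples, so a density near
    1/2 forces a small bias. *)
Lemma par_balanced (g : 'I_n -> bool) (a d : R) :
    0 <= a -> 2^-1 - d <= Pr (fun t : K.-tuple 'I_n => par g t) -> 2 * d <= a ^+ 2 ->
  `|1 - 2 * Pr (fun t : k.+1.-tuple 'I_n => par g t)| <= a.
Proof.
move=> a0; rewrite Pr_par_cat // => Hp da.
by rewrite -(ler_pXn2r (_ : 0 < 2)%N) ?nnegrE // -normrX ger0_norm ?sqr_ge0 //; lra.
Qed.

Lemma Pr_neq_le (T : finType) (p q : T -> bool) :
  Pr p - Pr (fun x => p x != q x) <= Pr q.
Proof.
have := @Pr_union R T p q (fun x => p x != q x) => /(_ _) U.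
have {}U : Pr p <= Pr q + Pr (fun x => p x != q x) by apply: U => x ->; case: (q x).
by lra.
Qed.

Variables (eps eta : R).
Hypothesis eps0 : 0 < eps.
Hypothesis eta0 : 0 < eta.
Hypothesis eps_eta : 100 * k.+1%:R * eps <= eta ^+ 2.
Hypothesis eta_small : 2048 * k.+1%:R ^+ 2 * K`!%:R * eta <= 1.
Hypothesis n_large : (1 + K * K)%:R / n%:R <= eps.

Let k1 : 1 <= k.+1%:R :> R. Proof. by rewrite ler1n. Qed.

Let K1 : 1 <= K`!%:R :> R. Proof. by rewrite ler1n fact_gt0. Qed.

(** The first three factors form the vertex error of [vertex_stability]. The factor 128 is twice the
    64 of [Pr_crossing], which yields the final ratio 2 between missing and bad edges. *)
Let eta_e6 : 16 * k.+1%:R ^+ 2 * eta * (128 * K`!%:R) <= 1.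
Proof. by apply: le_trans eta_small; rewrite le_eqVlt; apply/orP; left; apply/eqP; ring. Qed.

Let e6_small : 16 * k.+1%:R ^+ 2 * eta <= 128^-1.
Proof.
have e60 : 0 <= 16 * k.+1%:R ^+ 2 * eta by rewrite !mulr_ge0 ?sqr_ge0 ?ler0n // ltW.
have := ler_wpM2l e60 K1; have := eta_e6; lra.
Qed.

Let eta_le : eta <= 2048^-1.
Proof.
have k2 : 1 <= k.+1%:R ^+ 2 :> R by rewrite expr_ge1.
have := ler_wpM2r (ltW eta0) k2; have := e6_small; lra.
Qed.

Let eps_le : 100 * eps <= eta ^+ 2.
Proof. have := ler_wpM2r (ltW eps0) k1; have := eps_eta; lra. Qed.

Let eps_le1 : eps <= 2048^-1.
Proof.
have : eta ^+ 2 <= eta by rewrite expr2 ler_piMl // ?ltW //; have := eta_le; lra.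
have := eta_le; have := eps_le; have := eps0; lra.
Qed.

Let edge_dens : 2^-1 - eps <= Pr (fun t : K.-tuple 'I_n => edge t).
Proof. by apply: le_trans edge_density; rewrite lerD2l lerN2. Qed.

Lemma exists_vertex_par : exists g, forall x,
  Pr (fun t : (k + k.+1).-tuple 'I_n => edge (x :: t) != par g (x :: t))
    <= 16 * k.+1%:R ^+ 2 * eta.
Proof.
pose G (P Q : k.+1.-tuple 'I_n) := edge (P ++ Q).
have Gs : symmetric G by move=> P Q; apply: edge_sym; rewrite perm_catC.
have T0 := card_tuple_gt0 V0 k.+1.
have [||P0 P0P] := @triangle_free_stability R _ G eps T0 Gs edge_free eps0.
- by have := eps_le1; lra.
- by have := edge_dens; rewrite (Pr_tuple_cat _ _ _ edge).
pose f s := edge (P0 ++ s).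
have f_sym : perm_invariant f by move=> s t st; apply: edge_sym; rewrite perm_cat2l.
have [g0 g0P] := @par_stability R _ V0 k edge f (13 * eps) edge_sym f_sym P0P.
(* 13 comes from [triangle_free_stability], and [1 + 2 * k.+1] is at most [3 * k.+1]. *)
have e2 : (1 + 2 * k.+1%:R) * (13 * eps) <= 39 * (k.+1%:R * eps).
  by have := ler_wpM2r (ltW eps0) k1; lra.
have {}g0P := le_trans g0P e2.
have ke : eps <= k.+1%:R * eps by have := ler_wpM2r (ltW eps0) k1; lra.
apply: (@vertex_stability R _ V0 k edge edge_sym edge_free eta g0).
- exact: ltW.
- by have := eta_le; lra.
- by apply: le_trans g0P _; have := eps_eta; have := eps0; lra.
(* The parity rule inherits the edge density up to its error. Twice the total defect is at most
   [80 * k.+1 * eps], within the bound [eps_eta]. *)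
- apply: (@par_balanced g0 eta (eps + 39 * (k.+1%:R * eps))); first exact: ltW.
    have := Pr_neq_le (fun u : k.+1.-tuple 'I_n * k.+1.-tuple 'I_n => edge (u.1 ++ u.2))
      (fun u => par g0 (u.1 ++ u.2)).
    have := edge_dens; rewrite (Pr_tuple_cat _ _ _ edge) (Pr_tuple_cat _ _ _ (par g0)); lra.
  by have := eps_eta; have := eps0; lra.
move=> x; apply: le_trans (edge_degree x).
have KKn : (K * K)%:R / n%:R <= eps.
  by apply: le_trans n_large; rewrite ler_pM2r ?invr_gt0 ?ltr0n // ler_nat leq_addl.
have := edge_dens; have : 2 * eps <= eta.
  have : eta ^+ 2 <= eta by rewrite expr2 ler_piMl // ?ltW //; have := eta_le; lra.
  have := eps_le; have := eps0; lra.
lra.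
Qed.

Lemma extremal_odd_family : exists g, H = odd_family K g.
Proof.
have [g gP] := exists_vertex_par; exists g; set O := odd_family K g.
pose e6 : R := 16 * k.+1%:R ^+ 2 * eta.
have avg : Pr (fun u : k.+1.-tuple 'I_n * k.+1.-tuple 'I_n =>
    edge (u.1 ++ u.2) != par g (u.1 ++ u.2)) <= e6.
  rewrite (Pr_tuple_cat_cons R k (fun s => edge s != par g s)).
  by rewrite -[leRHS](@mean_cst R 'I_n) //; apply: le_mean.
have bal : `|1 - 2 * Pr (fun Q : k.+1.-tuple 'I_n => par g Q)| <= 4^-1.
  apply: (@par_balanced g 4^-1 (eps + e6)); first by rewrite invr_ge0 ler0n.
    have := Pr_neq_le (fun u : k.+1.-tuple 'I_n * k.+1.-tuple 'I_n => edge (u.1 ++ u.2))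
      (fun u => par g (u.1 ++ u.2)).
    have := edge_dens; rewrite (Pr_tuple_cat _ _ _ edge) (Pr_tuple_cat _ _ _ (par g)); lra.
  by have := e6_small; have := eps_le1; rewrite /e6; lra.
have large : (k.+1 * (k.+1 + k.+1 + k.+1))%:R / #|'I_n|%:R <= 8^-1 :> R.
  rewrite card_ord; apply: le_trans (_ : _ <= (1 + K * K)%:R / n%:R) _.
    by rewrite ler_pM2r ?invr_gt0 ?ltr0n // ler_nat; clear; nia.
  by have := eps_le1; have := n_large; lra.
pose mi := miss edge g.
pose cr := @crossing R _ k edge g.
have Pcr : Pr (fun t : K.-tuple 'I_n => cr t) <= 64 * e6 * Pr (fun t : K.-tuple 'I_n => mi t).
  exact: (Pr_crossing V0 gP).
have oddE E : (E \in O) = (#|E| == K) && par g (enum E).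
  have {1}-> : E = [set x in enum E] by apply/setP => x; rewrite inE mem_enum.
  case: eqP => cE; first by rewrite odd_family_seq -?cardE // enum_uniq.
  rewrite inE /=; apply/negbTE; rewrite negb_and; apply/orP; left; apply/eqP.
  by rewrite cardsE (card_uniqP (enum_uniq E)) -cardE.
(* Each bad edge provides one crossing ordering of itself, whereas in [cM] a missing set counts with
   all its orderings; hence the factor [K]! in [eta_small]. *)
have cD : (#|H :\: O| <= #|[pred t : K.-tuple 'I_n | cr t]|)%N.
  apply: leq_trans (leq_imset_card (fun t : K.-tuple 'I_n => [set x in t]) _).
  apply/subset_leq_card/subsetP => E; rewrite inE oddE => /andP[pE EH].
  have sE : size (enum E) = K by rewrite -cardE (H_unif EH).
  have hE : edge (enum E).
    rewrite edge_size //; have -> // : [set x in enum E] = E.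
    by apply/setP => x; rewrite inE mem_enum.
  rewrite (H_unif EH) eqxx /= in pE.
  have [t tE tc] := exists_crossing V0 edge_sym edge_uniq edge_free bal large sE hE pE.
  apply/imsetP; exists t; first by rewrite inE.
  by apply/setP => x; rewrite inE (perm_mem tE) mem_enum.
have cM : Pr (fun t : K.-tuple 'I_n => mi t) * (n ^ K)%:R = (K`! * #|O :\: H|)%:R.
  have := @Pr_family R _ V0 K (O :\: H); rewrite card_ord => <- => [|E]; last first.
    by rewrite inE oddE => /and3P[_ /eqP].
  congr (_ * _); apply: eq_Pr => t; rewrite in_setD odd_family_seq ?size_tuple //.
  by rewrite /mi /miss edge_size ?size_tuple // andbA andbC.
have pn : 0 < (n ^ K)%:R :> R by rewrite ltr0n expn_gt0 n0.
(* Combining the bounds, the bad edges number at most [64 * e6 * K]! times the missing ones, and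
   this factor is at most 1/2. *)
have cDM : (2 * #|H :\: O| <= #|O :\: H|)%N.
  rewrite -(ler_nat R) natrM.
  have : #|H :\: O|%:R <= Pr (fun t : K.-tuple 'I_n => cr t) * (n ^ K)%:R.
    have := @Pr_card R _ (fun t : K.-tuple 'I_n => cr t) (card_tuple_gt0 V0 K).
    by rewrite card_tuple card_ord => ->; rewrite ler_nat.
  have := ler_wpM2r (ltW pn) Pcr; rewrite -[64 * e6 * _ * _]mulrA cM natrM.
  have := eta_e6; rewrite -/e6 => e6K.
  have m0 : 0 <= #|O :\: H|%:R :> R by rewrite ler0n.
  have := ler_wpM2r m0 e6K; lra.
have cOH : (#|O| <= #|H|)%N.
  by apply: leq_trans H_bmax; have := card_odd_family_le k.+1 g; rewrite mul2n -addnn.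
exact: eq_of_card_setD cDM cOH.
Qed.

End Extremal.

(** * Choice of the constants and of the threshold for [n] *)

Lemma exists_parameters (R : realFieldType) (c f : R) : 0 < c -> 0 < f ->
  exists eps eta : R, [/\ 0 < eps, 0 < eta, 100 * c * eps <= eta ^+ 2
    & 2048 * c ^+ 2 * f * eta <= 1].
Proof.
move=> c0 f0; pose eta := (2048 * c ^+ 2 * f)^-1.
have p0 : 0 < 2048 * c ^+ 2 * f by rewrite !mulr_gt0 ?exprn_gt0.
have q0 : 0 < 100 * c by rewrite mulr_gt0.
have eta0 : 0 < eta by rewrite invr_gt0.
exists (eta ^+ 2 / (100 * c)), eta; split=> //.
- by rewrite divr_gt0 ?exprn_gt0.
- by rewrite mulrCA mulfV ?mulr1 // gt_eqF.
- by rewrite mulfV // gt_eqF.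
Qed.

Lemma exists_div_le (R : archiRealFieldType) (x eps : R) : 0 <= x -> 0 < eps ->
  exists n0, forall n, (n0 <= n)%N -> (0 < n)%N /\ x / n%:R <= eps.
Proof.
move=> x0 eps0; have y0 : 0 <= x / eps by rewrite divr_ge0 // ltW.
exists (Num.bound (x / eps)).+1 => n nx; have n0 := leq_trans (ltn0Sn _) nx.
split=> //; rewrite ler_pdivrMr ?ltr0n // mulrC -ler_pdivrMr //.
by apply: le_trans (ltW (archi_boundP y0)) _; rewrite ler_nat ltnW.
Qed.

Lemma extremal_threshold (R : archiRealFieldType) (k : nat) :
  exists n0, forall n, (n0 <= n)%N -> forall G : {set {set 'I_n}},
    uniform (k.+1 + k.+1)%N G -> ~ has_C3 k.+1 G ->
    (forall F : {set {set 'I_n}}, uniform (k.+1 + k.+1)%N F -> ~ has_C3 k.+1 F ->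
      (#|F| <= #|G|)%N) ->
    (bmax n k.+1 <= #|G|)%N -> exists g, G = odd_family (k.+1 + k.+1)%N g.
Proof.
set K := (k.+1 + k.+1)%N.
have k0 : 0 < k.+1%:R :> R by rewrite ltr0n.
have f0 : 0 < K`!%:R :> R by rewrite ltr0n fact_gt0.
have [eps [eta [eps0 eta0 eps_eta eta_small]]] := exists_parameters k0 f0.
have [n1 n1P] := exists_div_le (ler0n R (1 + K * K)) eps0.
exists n1 => n /n1P[n0 n_large] G Gu Gf Gm Gb.
exact: (extremal_odd_family n0 Gu Gf Gm Gb eps0 eta0 eps_eta eta_small n_large).
Qed.

Local Close Scope ring_scope.

Theorem theorem1 (k : nat) (hk : 1 <= k) :
  exists n0 : nat, forall n : nat, n0 <= n ->
    forall H : {set {set 'I_n}},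
      uniform (2 * k) H -> ~ has_C3 k H ->
      #|H| <= bmax n k /\
      (#|H| = bmax n k ->
         exists a : nat, a <= n /\ #|Bhyp n k a| = bmax n k /\ hiso H (Bhyp n k a)).
Proof.
case: k hk => // k _; have -> : 2 * k.+1 = k.+1 + k.+1 by rewrite mul2n addnn.
have [n0 n0P] := extremal_threshold rat k; exists n0 => n /n0P extremal H Hu Hf.
have [G [Gu Gf Gm]] := exists_extremal Hu Hf.
(* If even the largest C3-free [G] has fewer than [bmax] edges, the bound is strict and equality
   cannot occur. Otherwise [G] is an odd family, so it has at most [bmax] edges. *)
have [bG|Gb] := leqP (bmax n k.+1) #|G|; last first.
  have HG := Gm H Hu Hf; split; first by apply: leq_trans HG (ltnW _).
  by move=> HE; rewrite HE leqNgt Gb in HG.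
have [g Gg] := extremal G Gu Gf Gm bG.
have Gle : #|G| <= bmax n k.+1.
  by rewrite Gg; have := card_odd_family_le k.+1 g; rewrite mul2n -addnn.
split=> [|HE]; first exact: leq_trans (Gm H Hu Hf) Gle.
(* A hypergraph [H] attaining [bmax] is itself extremal, so the structure result applies to it
   directly. *)
have [||g' Hg] := extremal H Hu Hf.
- by move=> F Fu Ff; rewrite HE; apply: leq_trans (Gm F Fu Ff) Gle.
- by rewrite HE.
have [a an iso] := hiso_odd_family k.+1 g'.
have iso' : hiso H (Bhyp n k.+1 a) by move: iso; rewrite mul2n -addnn -Hg.
by exists a; split=> //; split=> //; rewrite -(hiso_card iso').
Qed.
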